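(* Let $a,b$ be relatively prime integers with $b>a>1$. Suppose that $R=k[x^a,x^b]$ with $k$ a field, or that $R$ is a one-dimensional analytically irreducible residually rational ring with maximal ideal $\mathfrak{m}=(t^a,t^b)$ for some $t\in\overline{R}$. Let $I$ be a monomial ideal of $R$. Then $I\otimes_R I^*$ has a minimal generating set such that at least $2\mu(I)-2$ of the generators are torsion elements.
   Context: $I^*=\operatorname{Hom}_R(I,R)$; $\mu(-)$ is the minimal number of generators of a module. An element $y$ of an $R$-module is torsion if $ry=0$ for some nonzero $r\in R$. Local rings are Noetherian; a local ring is analytically irreducible if its completion is a domain, and an analytically irreducible local ring is residually rational if it has the same residue field as its integral closure; $\overline{R}$ is the integral closure of $R$ in its field of fractions. A monomial ideal is a (nonzero) ideal generated by powers of $x$ (when $R=k[x^a,x^b]$) or by powers of $t$ (in the local case). *)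

(* Defs.v *)
From HB Require Import structures.
From mathcomp Require Import all_boot all_order all_algebra.
From mathcomp Require Import boolp classical_sets functions.

Set Implicit Arguments.
Unset Strict Implicit.
Unset Printing Implicit Defensive.

Import GRing.Theory.

Local Open Scope ring_scope.
Local Open Scope classical_set_scope.
Local Open Scope quotient_scope.

Section Modules.
Variable R : comNzRingType.
Implicit Type M : lmodType R.

Definition lin_span M (G : set M) : set M :=
  [set x | exists2 s : seq (R * M),
     forall p, p \in s -> G p.2 & x = \sum_(p <- s) p.1 *: p.2].

Lemma span0 M (G : set M) : lin_span G 0.
Proof. by exists [::]; rewrite ?big_nil. Qed.

Lemma spanD M (G : set M) x y :
  lin_span G x -> lin_span G y -> lin_span G (x + y).
Proof.
move=> [s sG ->] [s' s'G ->]; exists (s ++ s'); last by rewrite big_cat.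
by move=> p; rewrite mem_cat => /orP[/sG|/s'G].
Qed.

Lemma spanZ M (G : set M) a x : lin_span G x -> lin_span G (a *: x).
Proof.
move=> [s sG ->]; exists [seq (a * p.1, p.2) | p <- s].
  by move=> _ /mapP[p /sG Gp ->].
by rewrite big_map scaler_sumr; apply: eq_bigr => p _; rewrite scalerA.
Qed.

Lemma spanB M (G : set M) x y :
  lin_span G x -> lin_span G y -> lin_span G (x - y).
Proof. by move=> Gx Gy; rewrite -scaleN1r; apply/spanD/spanZ. Qed.

Lemma sub_span M (G : set M) : G `<=` lin_span G.
Proof.
move=> x Gx; exists [:: (1, x)]; last by rewrite big_seq1 scale1r.
by move=> p; rewrite inE => /eqP->.
Qed.

Definition generates M (s : seq M) : Prop := lin_span [set` s] = setT.

(* Among all finite generating families, one with as few members as possible.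
   Such a family is in particular irredundant and without repetitions. *)
Definition minimal_generating M (s : seq M) : Prop :=
  generates s /\ forall s' : seq M, generates s' -> (size s <= size s')%N.

(* Junk value 0 when M is not finitely generated. *)
Definition mu M : nat :=
  match pselect (exists n, `[< exists2 s : seq M, generates s & size s = n >])
  with
  | left P => ex_minn P
  | right _ => 0%N
  end.

Definition torsion M (y : M) : Prop := exists2 r : R, r != 0 & r *: y = 0.

Definition noetherian : Prop :=
  forall I : submodClosed R^o, exists s : seq R^o, [set` I] = lin_span [set` s].

End Modules.

Section SubModule.
Variables (R : comNzRingType) (M : lmodType R) (N : submodClosed M).

Definition submod := {x : M | x \in N}.

HB.instance Definition _ := SubChoice.on submod.
HB.instance Definition _ := [SubChoice_isSubLmodule of submod by <:].

End SubModule.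

Section Dual.
Variables (R : comNzRingType) (M : lmodType R).

Definition linear_forms : {pred M -> R^o} := fun f => `[< linear f >].

Lemma linear_forms_closed : submod_closed linear_forms.
Proof.
split=> [|a f g /asboolP lf /asboolP lg]; apply/asboolP => b x y.
  by rewrite /= /0 /= scaler0 addr0.
have -> z : (a *: f + g) z = a *: f z + g z by [].
rewrite lf lg !scalerDr !scalerA [a * b]mulrC.
by rewrite -!addrA; congr (_ + _); rewrite addrCA.
Qed.

HB.instance Definition _ :=
  GRing.isSubmodClosed.Build R (M -> R^o) linear_forms linear_forms_closed.

Definition dual_module := submod linear_forms.

HB.instance Definition _ := GRing.Lmodule.on dual_module.

End Dual.

(* M (x)_R N is the quotient of the formal sums of pairs (x, y) by the least
   congruence making (x, y) |-> x (x) y bilinear; a formal sum is a sequence,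
   whose order is immaterial by tensor_catC. *)
Section Tensor.
Variables (R : comNzRingType) (M N : lmodType R).

Inductive tensor_rel : seq (M * N) -> seq (M * N) -> Prop :=
| tensor_refl s : tensor_rel s s
| tensor_sym s t : tensor_rel s t -> tensor_rel t s
| tensor_trans s t u : tensor_rel s t -> tensor_rel t u -> tensor_rel s u
| tensor_cat s s' t t' :
    tensor_rel s s' -> tensor_rel t t' -> tensor_rel (s ++ t) (s' ++ t')
| tensor_catC s t : tensor_rel (s ++ t) (t ++ s)
| tensor_Dl x x' y : tensor_rel [:: (x + x', y)] [:: (x, y); (x', y)]
| tensor_Dr x y y' : tensor_rel [:: (x, y + y')] [:: (x, y); (x, y')]
| tensor_ZC (a : R) x y : tensor_rel [:: (a *: x, y)] [:: (x, a *: y)]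
| tensor_0l y : tensor_rel [:: (0, y)] [::].

Definition tensor_eqb (s t : seq (M * N)) : bool := `[< tensor_rel s t >].

Lemma tensor_eqb_equiv : equiv_class_of tensor_eqb.
Proof.
split=> [s|s t|t s u]; first exact/asboolP/tensor_refl.
  by apply/asboolP/asboolP; apply: tensor_sym.
by move=> /asboolP st /asboolP tu; apply/asboolP/(tensor_trans st).
Qed.

Canonical tensor_eqb_equivRel := EquivRelPack tensor_eqb_equiv.
Canonical tensor_eqb_encModRel := defaultEncModRel tensor_eqb.

Definition tensor := {eq_quot tensor_eqb}.

HB.instance Definition _ : EqQuotient _ tensor_eqb tensor :=
  EqQuotient.on tensor.
HB.instance Definition _ := Choice.on tensor.

Definition tensor_scale_seq (a : R) (s : seq (M * N)) :=
  [seq (a *: p.1, p.2) | p <- s].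

Let piP s t : tensor_rel s t <-> \pi_tensor s = \pi_tensor t.
Proof.
split=> [st|]; first by apply/eqmodP/asboolP.
by move/eqmodP/asboolP.
Qed.

Let scale_rel a s t : tensor_rel s t ->
  tensor_rel (tensor_scale_seq a s) (tensor_scale_seq a t).
Proof.
elim=> [{}s|{}s {}t _|{}s {}t u _ IH _|s1 s2 t1 t2 _ IH1 _ IH2|{}s {}t
       |x x' y|x y y'|b x y|y] /=.
- exact: tensor_refl.
- exact: tensor_sym.
- exact: tensor_trans.
- by rewrite /tensor_scale_seq !map_cat; apply: tensor_cat.
- by rewrite /tensor_scale_seq !map_cat; apply: tensor_catC.
- by rewrite scalerDr; apply: tensor_Dl.
- exact: tensor_Dr.
- by rewrite scalerA mulrC -scalerA; apply: tensor_ZC.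
- by rewrite scaler0; apply: tensor_0l.
Qed.

Let repr_rel s : tensor_rel (repr (\pi_tensor s)) s.
Proof. by apply/piP; rewrite reprK. Qed.

Definition tensor_add (u v : tensor) : tensor := \pi_tensor (repr u ++ repr v).
Definition tensor_scale (a : R) (u : tensor) : tensor :=
  \pi_tensor (tensor_scale_seq a (repr u)).
Definition tensor_opp (u : tensor) : tensor := tensor_scale (-1) u.
Definition tensor_zero : tensor := \pi_tensor [::].

Let add_pi s t : tensor_add (\pi_tensor s) (\pi_tensor t) = \pi_tensor (s ++ t).
Proof. by apply/piP/tensor_cat; apply: repr_rel. Qed.

Let scale_pi a s :
  tensor_scale a (\pi_tensor s) = \pi_tensor (tensor_scale_seq a s).
Proof. exact/piP/scale_rel/repr_rel. Qed.

Let addA : associative tensor_add.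
Proof.
elim/quotW=> s; elim/quotW=> t; elim/quotW=> u.
by rewrite (add_pi t u) (add_pi s t) !add_pi catA.
Qed.

Let addC : commutative tensor_add.
Proof.
elim/quotW=> s; elim/quotW=> t.
by rewrite (add_pi s t) (add_pi t s); apply/piP/tensor_catC.
Qed.

Let add0 : left_id tensor_zero tensor_add.
Proof. by elim/quotW=> ?; rewrite !add_pi. Qed.

Let scale0_rel s : tensor_rel (tensor_scale_seq 0 s) [::].
Proof.
elim: s => [|p s IH]; first exact: tensor_refl.
rewrite /= scale0r; exact: (@tensor_cat [:: _] [::] _ [::] (tensor_0l _) IH).
Qed.

Let scale_seqDl a b s :
  tensor_rel (tensor_scale_seq (a + b) s)
    (tensor_scale_seq a s ++ tensor_scale_seq b s).
Proof.
elim: s => [|p s IH]; first exact: tensor_refl.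
rewrite /= scalerDl.
apply: tensor_trans (tensor_cat (s := [:: _]) (tensor_Dl _ _ _) IH) _ => /=.
apply: (@tensor_cat [:: _] [:: _]); first exact: tensor_refl.
rewrite -cat_rcons -cats1; apply: (tensor_cat (s := _ :: _));
  last exact: tensor_refl.
by rewrite -cat1s; apply: tensor_catC.
Qed.

Let scaleDl u : {morph tensor_scale^~ u : a b / a + b >-> tensor_add a b}.
Proof.
by elim/quotW: u => s a b; rewrite !scale_pi add_pi; apply/piP/scale_seqDl.
Qed.

Let scale1 : left_id 1 tensor_scale.
Proof.
elim/quotW=> s; rewrite scale_pi; congr \pi.
rewrite /tensor_scale_seq -[RHS]map_id.
by apply: eq_map => -[x y]; rewrite /= scale1r.
Qed.

Let scale0 u : tensor_scale 0 u = tensor_zero.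
Proof. by elim/quotW: u => s; rewrite scale_pi; apply/piP/scale0_rel. Qed.

Let addN : left_inverse tensor_zero tensor_opp tensor_add.
Proof. by move=> u; rewrite -{2}[u]scale1 -scaleDl addNr scale0. Qed.

HB.instance Definition _ := GRing.isZmodule.Build tensor addA addC add0 addN.

Let scaleA a b u : tensor_scale a (tensor_scale b u) = tensor_scale (a * b) u.
Proof.
elim/quotW: u => s; rewrite (scale_pi b s) !scale_pi; congr \pi.
by rewrite /tensor_scale_seq -map_comp; apply: eq_map => p; rewrite /= scalerA.
Qed.

Let scaleDr : right_distributive tensor_scale +%R.
Proof.
move=> a; elim/quotW=> s; elim/quotW=> t.
rewrite [X in _ a X](add_pi s t) (scale_pi a s) (scale_pi a t) scale_pi.
by rewrite [RHS]add_pi /tensor_scale_seq map_cat.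
Qed.

HB.instance Definition _ :=
  GRing.Zmodule_isLmodule.Build R tensor scaleA scale1 scaleDr scaleDl.

Definition tens (x : M) (y : N) : tensor := \pi_tensor [:: (x, y)].

Lemma pi_tensorE s : \pi_tensor s = \sum_(p <- s) tens p.1 p.2.
Proof.
elim: s => [|[x y] s IH]; first by rewrite big_nil.
by rewrite big_cons -IH [RHS]add_pi.
Qed.

Lemma tensDl x x' y : tens (x + x') y = tens x y + tens x' y.
Proof. by rewrite [RHS]add_pi; apply/piP/tensor_Dl. Qed.

Lemma tensDr x y y' : tens x (y + y') = tens x y + tens x y'.
Proof. by rewrite [RHS]add_pi; apply/piP/tensor_Dr. Qed.

Lemma tensZl a x y : tens (a *: x) y = a *: tens x y.
Proof. by rewrite [RHS]scale_pi. Qed.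

Lemma tensZr a x y : tens x (a *: y) = a *: tens x y.
Proof. by rewrite -tensZl; apply/esym/piP/tensor_ZC. Qed.

Lemma tensor_universal (P : lmodType R) (f : M -> N -> P) :
  (forall y, linear (f^~ y)) -> (forall x, linear (f x)) ->
  exists! g : tensor -> P, linear g /\ forall x y, g (tens x y) = f x y.
Proof.
move=> fl fr.
pose F s := \sum_(p <- s) f p.1 p.2.
have f0 y : f 0 y = 0.
  by have := fl y (-1) 0 0; rewrite scaler0 addr0 scaleN1r addNr.
have fZl a x y : f (a *: x) y = a *: f x y.
  by have := fl y a x 0; rewrite f0 !addr0.
have f0r x : f x 0 = 0.
  by have := fr x (-1) 0 0; rewrite scaler0 addr0 scaleN1r addNr.
have fZr a x y : f x (a *: y) = a *: f x y.
  by have := fr x a y 0; rewrite f0r !addr0.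
have FP s t : tensor_rel s t -> F s = F t.
  elim=> {s t}; rewrite {}/F.
  - by [].
  - by [].
  - by move=> s t u _ -> _ ->.
  - by move=> s s' t t' _ ss' _ tt'; rewrite !big_cat ss' tt'.
  - by move=> s t; rewrite !big_cat /= addrC.
  - by move=> x x' y; rewrite !big_cons !big_nil /= !addr0;
       rewrite -[x in LHS]scale1r fl scale1r.
  - by move=> x y y'; rewrite !big_cons !big_nil /= !addr0;
       rewrite -[y in LHS]scale1r fr scale1r.
  - by move=> a x y; rewrite !big_seq1 fZl fZr.
  - by move=> y; rewrite big_seq1 big_nil f0.
pose g (u : tensor) := F (repr u).
have gpi s : g (\pi_tensor s) = F s by apply/FP/repr_rel.
exists g; split=> [|h [hl hf]].
  split=> [a|x y]; last by rewrite gpi /F big_seq1.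
  do 2!elim/quotW=> ?; rewrite [_ *: _]scale_pi [_ + _]add_pi !gpi /F big_cat.
  rewrite big_map scaler_sumr; congr (_ + _).
  by apply: eq_bigr => p _; rewrite fZl.
have hD u v : h (u + v) = h u + h v.
  by rewrite -[u in LHS]scale1r hl scale1r.
have h0 : h 0 = 0.
  by have := hl (-1) 0 0; rewrite scaler0 addr0 scaleN1r addNr.
apply/funext; elim/quotW=> s; rewrite gpi pi_tensorE (big_morph h hD h0).
by apply: eq_bigr => p _; rewrite hf.
Qed.

End Tensor.

Section LocalRings.
Variable R : comNzRingType.

Definition maximal_ideal (m : idealr R) : Prop :=
  forall J : idealr R, {subset m <= J} -> {subset J <= m}.

Definition unique_maximal_ideal (m : idealr R) : Prop :=
  maximal_ideal m /\ forall n : idealr R, maximal_ideal n -> n =i m.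

Definition noetherian_local (m : idealr R) : Prop :=
  noetherian R /\ unique_maximal_ideal m.

Definition prime_chain (d : nat) (P : nat -> prime_idealr R) : Prop :=
  forall i, (i < d)%N ->
    {subset P i <= P i.+1} /\ ~ {subset P i.+1 <= P i}.

Definition krull_dim_is (d : nat) : Prop :=
  (exists P, prime_chain d P) /\ ~ (exists P, prime_chain d.+1 P).

End LocalRings.

(* The m-adic completion is the ring of m-adic Cauchy sequences modulo the
   ideal of sequences converging to 0. *)
Section Completion.
Variables (R : comNzRingType) (m : idealr R).

Definition ideal_exp (n : nat) : set R :=
  lin_span (M := R^o) [set r | exists2 s : n.-tuple R, {subset s <= m} &
                            r = \prod_(x <- s) x].

Definition cauchy_seqs : {pred nat -> R} := fun f =>
  `[< forall n, exists k, forall i j, (k <= i)%N -> (k <= j)%N ->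
        ideal_exp n (f i - f j) >].

Lemma ideal_expM n a r : ideal_exp n r -> ideal_exp n (a * r).
Proof. exact: spanZ. Qed.

Lemma ideal_expB n r s : ideal_exp n r -> ideal_exp n s -> ideal_exp n (r - s).
Proof. exact: (@spanB R R^o). Qed.

Lemma ideal_expD n r s : ideal_exp n r -> ideal_exp n s -> ideal_exp n (r + s).
Proof. exact: (@spanD R R^o). Qed.

Lemma ideal_exp1 r : ideal_exp 1 r -> r \in m.
Proof.
move=> [s sm ->]; rewrite big_seq; apply: rpred_sum => p /sm[t tm ->].
apply/idealMr; case/tupleP: t tm => x t tm; rewrite tuple0 big_seq1.
by apply: tm; rewrite inE eqxx.
Qed.

Lemma cauchy_seqs_closed : subring_closed cauchy_seqs.
Proof.
split=> [|f g /asboolP fC /asboolP gC|f g /asboolP fC /asboolP gC];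
  apply/asboolP => n.
- by exists 0%N => i j _ _; rewrite /= subrr; apply: span0.
- have [k fk] := fC n; have [l gl] := gC n; exists (maxn k l) => i j.
  rewrite !geq_max => /andP[ki li] /andP[kj lj].
  have -> : (f - g) i - (f - g) j = (f i - f j) - (g i - g j).
    rewrite [(f - g) i]/(_ - _) [(f - g) j]/(_ - _) !opprD !opprK.
    by rewrite !addrA; congr (_ + _); apply: addrAC.
  exact: ideal_expB (fk _ _ ki kj) (gl _ _ li lj).
- have [k fk] := fC n; have [l gl] := gC n; exists (maxn k l) => i j.
  rewrite !geq_max => /andP[ki li] /andP[kj lj].
  have -> : (f * g) i - (f * g) j = f i * (g i - g j) + g j * (f i - f j).
    rewrite [(f * g) i]/(_ * _) [(f * g) j]/(_ * _) !mulrBr.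
    by rewrite [g j * f i]mulrC [g j * f j]mulrC addrA subrK.
  exact: ideal_expD (ideal_expM _ (gl _ _ li lj)) (ideal_expM _ (fk _ _ ki kj)).
Qed.

HB.instance Definition _ :=
  GRing.isSubringClosed.Build (nat -> R) cauchy_seqs cauchy_seqs_closed.

Definition cauchy_ring := {f : nat -> R | f \in cauchy_seqs}.

HB.instance Definition _ := SubChoice.on cauchy_ring.
HB.instance Definition _ := [SubChoice_isSubComNzRing of cauchy_ring by <:].

Definition null_seqs : {pred cauchy_ring} := fun f =>
  `[< forall n, exists k, forall i, (k <= i)%N -> ideal_exp n (val f i) >].

Lemma null_seqs_closed : idealr_closed null_seqs.
Proof.
split=> [||f u v /asboolP u0 /asboolP v0].
- by apply/asboolP => n; exists 0%N => i _; rewrite raddf0; apply: span0.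
- apply/asboolPn => /(_ 1%N)[k /(_ k (leqnn k))]; rewrite rmorph1.
  by move/ideal_exp1; rewrite idealr1.
- apply/asboolP => n; have [k uk] := u0 n; have [l vl] := v0 n.
  exists (maxn k l) => i; rewrite geq_max => /andP[ki li].
  have -> : val (f * u + v) i = val f i * val u i + val v i by [].
  exact: ideal_expD (ideal_expM _ (uk _ ki)) (vl _ li).
Qed.

HB.instance Definition _ :=
  isIdealr.Build cauchy_ring null_seqs null_seqs_closed.

Definition completion := {ideal_quot null_seqs}.

HB.instance Definition _ := GRing.ComNzRing.on completion.

Definition analytically_irreducible : Prop :=
  GRing.integral_domain_axiom completion.

End Completion.

Section IntegralClosure.
Variable R : idomainType.

Definition integral_elts : {pred {fraction R}} :=
  fun u => `[< integralOver (@tofrac R) u >].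

Lemma integral_elts_closed : subring_closed integral_elts.
Proof.
split=> [|u v /asboolP iu /asboolP iv|u v /asboolP iu /asboolP iv];
  apply/asboolP.
- exact: integral1.
- exact: integral_sub.
- exact: integral_mul.
Qed.

HB.instance Definition _ :=
  GRing.isSubringClosed.Build {fraction R} integral_elts integral_elts_closed.

Definition int_closure := {u : {fraction R} | u \in integral_elts}.

HB.instance Definition _ := SubChoice.on int_closure.
HB.instance Definition _ := [SubChoice_isSubComNzRing of int_closure by <:].

Lemma tofrac_integral (r : R) : tofrac r \in integral_elts.
Proof. exact/asboolP/integral_id. Qed.

Definition to_int_closure (r : R) : int_closure :=
  exist _ (tofrac r) (tofrac_integral r).

(* The map of residue fields induced by the inclusion of R in its integral
   closure (whose maximal ideal is n) is an isomorphism. *)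
Definition residually_rational (m : idealr R) : Prop :=
  exists2 n : idealr int_closure, unique_maximal_ideal n &
  exists2 phi : {ideal_quot m} -> {ideal_quot n}, bijective phi &
    forall r : R, phi (\pi_{ideal_quot m} r)
                = \pi_{ideal_quot n} (to_int_closure r).

End IntegralClosure.

Section MonomialRing.
Variables (k : fieldType) (a b : nat).

(* k[x^a, x^b] is the image of k[X, Y] under X |-> x^a, Y |-> x^b. *)
Definition monomial_subring : {pred {poly k}} := fun p =>
  `[< exists q : {poly {poly k}}, p = (map_poly (comp_poly 'X^a) q).['X^b] >].

Lemma monomial_subring_closed : subring_closed monomial_subring.
Proof.
split=> [|p p' /asboolP[q ->] /asboolP[q' ->]
         |p p' /asboolP[q ->] /asboolP[q' ->]];
  apply/asboolP.
- by exists 1; rewrite rmorph1 hornerC.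
- by exists (q - q'); rewrite rmorphB hornerD hornerN.
- by exists (q * q'); rewrite rmorphM hornerM.
Qed.

HB.instance Definition _ :=
  GRing.isSubringClosed.Build {poly k} monomial_subring monomial_subring_closed.

Definition monomial_ring := {p : {poly k} | p \in monomial_subring}.

HB.instance Definition _ := SubChoice.on monomial_ring.
HB.instance Definition _ := [SubChoice_isSubComNzRing of monomial_ring by <:].

End MonomialRing.

(* A nonzero ideal of R generated by elements that are powers of x, an element
   of an overring A of R. *)
Definition monomial_ideal (R A : comNzRingType) (emb : R -> A) (x : A)
    (I : submodClosed R^o) : Prop :=
  (exists2 r : R^o, r \in I & r != 0) /\
  exists2 G : set R^o, (forall g, G g -> exists n : nat, emb g = x ^+ n) &
    [set` I] = lin_span G.

(* Main.v *)
From HB Require Import structures.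
Require Import Defs.
From mathcomp Require Import all_boot all_order all_algebra.
From mathcomp Require Import boolp classical_sets functions.
From mathcomp Require Import zify ring.

(** Both rings are treated at once.  Let R lie in a domain A by [emb], let t in A
be nonzero with t^a = emb u and t^b = emb v, let the proper ideal m be generated
by u and v, and suppose that an element of R lying in t R[t] lies in m.  For
k[x^a, x^b] take the polynomials without constant term for m; in the local case,
an element of t R[t] outside m would make t, hence t^a = u, invertible in the
integral closure, and then u invertible in R ([expansion_maximal]).  Elements
of R[t] are handled through their finite expansions sum_j emb (r_j) t^j.  A
coefficient r_j in m can be pushed to the degrees j + a and j + b, so an element
cannot have its first essential term in a degree outside the semigroup ideal that
supports another expansion of it ([expansion_mem_lead]).  Thus ideals generated by
powers of t, and their duals, can be read off from sets of exponents.

Let S be the semigroup generated by a and b, and let E be the set of s such that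
t^s lies in I.  Writing integers as i a + j b turns E into the region above a
staircase which is periodic under (i, j) -> (i - b, j + a); its corners over one
period, (P_k, Q_k) for k < n, running from (b, 0) down to (0, a), give the minimal
exponents e_k of E by e_k + ab = e_0 + P_k a + Q_k b ([staircase_exists]).  A form
g on I is determined by g (x_0), where x_k corresponds to t^(e_k), and the exponents
allowed for g (x_0) are the s with s + E inside e_0 + S.  The minimal ones are read
off from the inner corners of the staircase:
h_k = (b - P_k) a + (a - Q_(k+1)) b ([dual_cornerP]).  So I^* has the same number n
of minimal generators g_k, and the n^2 tensors of the x_l and the g_k form a
minimal generating set.

Now x_0 (x (x) g) = g(x) (x_0 (x) iota), iota being the inclusion of I in R.  Hence
x (x) g - r (x' (x) g') is torsion as soon as g(x) = r g'(x') ([torsion_tens]).  The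
corner coordinates give
  g_k (x_k) = v^(a - (Q_(k+1) - Q_k)),   g_k (x_(k+1)) = u^(b - (P_k - P_(k+1))),
with indices taken cyclically.  Among the n tensors of the first kind, subtract
from each of them the appropriate multiple of the one of least exponent; do the
same for the second kind.  These elementary operations preserve minimal generation,
and for n >= 2 they produce 2 (n - 1) distinct torsion members. *)

Set Implicit Arguments.
Unset Strict Implicit.
Unset Printing Implicit Defensive.

Import GRing.Theory.

Local Open Scope ring_scope.
Local Open Scope classical_set_scope.
Local Open Scope quotient_scope.

(** * Staircases of ideals of the semigroup generated by a and b *)

Section Staircase.
Local Open Scope nat_scope.
Variables a b : nat.
Hypotheses (a_gt0 : 0 < a) (b_gt0 : 0 < b) (coprime_ab : coprime a b).

Definition semigroup (s : nat) : Prop := exists i j, s = i * a + j * b.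

Lemma semigroupD s s' : semigroup s -> semigroup s' -> semigroup (s + s').
Proof. by move=> [i [j ->]] [i' [j' ->]]; exists (i + i'), (j + j'); lia. Qed.

Lemma semigroup_a : semigroup a. Proof. by exists 1, 0; lia. Qed.
Lemma semigroup_b : semigroup b. Proof. by exists 0, 1; lia. Qed.
Lemma semigroup0 : semigroup 0. Proof. by exists 0, 0. Qed.

(** Two representations differ by the syzygy b * a = a * b, and the one whose
second coefficient is below a has the largest first coefficient. *)
Lemma semigroup_rep_unique i j i' j' : j < a ->
  i * a + j * b = i' * a + j' * b -> exists c, j' = j + c * a /\ i = i' + c * b.
Proof.
move=> ja E.
have [le_jj'|lt_j'j] := leqP j j'.
  have : a %| (j' - j) * b.
    by apply/dvdnP; exists (i - i'); rewrite mulnBl mulnBl; lia.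
  rewrite Gauss_dvdl // => /dvdnP[c jj']; exists c; split; first by lia.
  have j'E : j' = j + c * a by lia.
  move: E; rewrite j'E mulnDl => E.
  have : i * a = (i' + c * b) * a by lia.
  by move/eqP; rewrite eqn_pmul2r // => /eqP.
have : a %| (j - j') * b.
  by apply/dvdnP; exists (i' - i); rewrite mulnBl mulnBl; lia.
rewrite Gauss_dvdl // => /dvdn_leq; lia.
Qed.

Lemma semigroup_rep s : a * b <= s -> exists i j, j < a /\ s = i * a + j * b.
Proof.
move=> abs.
have /eqP := chinese_modl coprime_ab s 0; have := chinese_modr coprime_ab s 0.
rewrite mod0n => /eqP/dvdnP[q ->]; rewrite -modnMml => sE.
have qa : q %% a < a by rewrite ltn_mod.
have le_s : q %% a * b <= s by apply: leq_trans abs; rewrite leq_mul2r ltnW ?orbT.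
move: sE; rewrite eq_sym eqn_mod_dvd // => /dvdnP[i iE].
by exists i, (q %% a); split=> //; lia.
Qed.

(** One period, from (b, 0) to (0, a), of the lattice path bounding a semigroup
ideal; the path goes on by translation by (- b, a). *)
Definition staircase n (P Q : nat -> nat) : Prop :=
  [/\ P 0 = b, P n = 0, Q 0 = 0, Q n = a
    & forall k, k < n -> P k.+1 < P k /\ Q k < Q k.+1].

(** By recursion on N, recording a new position exactly when f drops. *)
Lemma steps_exist (f : nat -> nat) N : (forall i j, i <= j -> f j <= f i) ->
  exists n Q, [/\ Q 0 = 0, Q n <= N,
    forall k, k < n -> f (Q k.+1) < f (Q k) /\ Q k < Q k.+1,
    forall j, Q n <= j -> j <= N -> f j = f (Q n)
    & forall j, j < Q n ->
        exists k, [/\ k < n, Q k <= j, j < Q k.+1 & f j = f (Q k)]].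
Proof.
move=> f_mono; elim: N => [|N [n [Q [Q0 Qn dec flat cov]]]].
  by exists 0, (fun=> 0); split=> // [[|]].
have [fE|fE] := eqVneq (f N.+1) (f N).
  exists n, Q; split=> // [|j Qj]; first by lia.
  rewrite leq_eqVlt => /orP[/eqP->|]; last by rewrite ltnS; apply: flat.
  by rewrite fE flat.
pose Q' k := if k <= n then Q k else N.+1.
have Q'E k : k <= n -> Q' k = Q k by rewrite /Q' => ->.
have Q'S : Q' n.+1 = N.+1 by rewrite /Q' ltnn.
have fN : f N.+1 < f N by rewrite ltn_neqAle fE f_mono.
exists n.+1, Q'; rewrite Q'S; split=> //.
- move=> k; rewrite ltnS leq_eqVlt => /orP[/eqP->|kn].
    rewrite Q'S Q'E //; split; last by lia.
    by rewrite -(flat N).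
  by rewrite !Q'E ?(ltnW kn) //; apply: dec.
- by move=> j Nj jN; congr f; lia.
move=> j jN; have [jQ|Qj] := ltnP j (Q n).
  have [k [kn Qk jQk fj]] := cov j jQ; exists k.
  by rewrite !Q'E ?(ltnW kn) //; split=> //; lia.
exists n; rewrite Q'S Q'E //; split=> //; exact: flat.
Qed.

(** Base the coordinates at the least element e_0 of E and let f(j) be the least i
such that e_0 + i a + j b - a b lies in E.  Then f is nonincreasing, f(0) = b by
minimality of e_0 and f(a) = 0, so the drops of f are the corners of the path. *)
Theorem staircase_exists (E : nat -> Prop) :
    (exists s, E s) ->
    (forall s, E s -> E (s + a)) -> (forall s, E s -> E (s + b)) ->
  exists n P Q e, [/\ staircase n P Q,
    forall k, k <= n -> e k + a * b = e 0 + P k * a + Q k * b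
    & forall s, E s <->
        exists2 k, k < n & exists2 s', semigroup s' & s = e k + s'].
Proof.
move=> exE Ea Eb.
have exEb : exists s, `[< E s >] by have [s Es] := exE; exists s; apply/asboolP.
have EM s i j : E s -> E (s + i * a + j * b).
  move=> Es; have Ei : E (s + i * a).
    elim: i => [|i IH]; first by rewrite addn0.
    by rewrite mulSn [a + _]addnC addnA; apply: Ea.
  elim: j => [|j IH]; first by rewrite addn0.
  by rewrite mulSn [b + _]addnC addnA; apply: Eb.
case: (ex_minnP exEb) => e0 /asboolP Ee0 min_e0.
have e0_le s : E s -> e0 <= s by move=> /asboolP; apply: min_e0.
pose W j i :=
  `[< a * b <= e0 + i * a + j * b /\ E (e0 + i * a + j * b - a * b) >].
have W_b j : exists i, W j i.
  exists b; apply/asboolP; split; first by lia.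
  by have := EM e0 0 j Ee0; congr E; lia.
pose f j := ex_minn (W_b j).
have fW j : W j (f j) by rewrite /f; case: ex_minnP.
have f_le j i : W j i -> f j <= i by rewrite /f; case: ex_minnP => ? _; apply.
have f_mono i j : i <= j -> f j <= f i.
  move=> ij; apply: f_le; have /asboolP[ge Ei] := fW i; apply/asboolP.
  split; first by nia.
  have := EM _ 0 (j - i) Ei; congr E; rewrite mulnBl.
  have : i * b <= j * b by rewrite leq_mul2r ij orbT.
  by lia.
have f0 : f 0 = b.
  have /asboolP[ge /e0_le e0f] := fW 0.
  apply/eqP; rewrite eqn_leq; apply/andP; split.
    by apply: f_le; apply/asboolP; split; [lia | have := Ee0; congr E; lia].
  by rewrite -(leq_pmul2r a_gt0); lia.
have fa : f a = 0.
  suff : f a <= 0 by lia.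
  by apply: f_le; apply/asboolP; split; [lia | have := Ee0; congr E; lia].
have f_gt0 j : j < a -> 0 < f j.
  move=> ja; rewrite lt0n; apply/negP => /eqP fj.
  have /asboolP[] := fW j; rewrite fj mul0n addn0 => ge /e0_le.
  have : j * b < a * b by rewrite ltn_mul2r b_gt0.
  by lia.
have [n [Q [Q0 Qn dec flat cov]]] := steps_exist a f_mono.
(* f is positive before a and vanishes at a, so the last drop occurs at a *)
have {flat}Qn : Q n = a.
  apply/eqP; rewrite eqn_leq Qn leqNgt; apply/negP => lt_a.
  by have := f_gt0 _ lt_a; rewrite -(flat a) ?fa // ltnW.
exists n, (f \o Q), Q, (fun k => e0 + f (Q k) * a + Q k * b - a * b).
have e0E : e0 + f (Q 0) * a + Q 0 * b - a * b = e0 by rewrite Q0 f0; lia.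
split=> [|k kn|s]; first by split=> //=; rewrite ?Q0 ?Qn.
  rewrite e0E /=; have /asboolP[] := fW (Q k); lia.
split=> [Es|[k kn [_ [i [j ->]] ->]]]; last first.
  by rewrite addnA; apply: EM; have /asboolP[] := fW (Q k).
have le_es := e0_le _ Es.
have /semigroup_rep[i [j [ja sE]]] : a * b <= s + a * b - e0 by lia.
have [k [kn Qk _ fj]] := cov j ltac:(by rewrite Qn).
have fi : f j <= i.
  by apply: f_le; apply/asboolP; split; [lia | have := Es; congr E; lia].
exists k => //; exists ((i - f j) * a + (j - Q k) * b).
  by exists (i - f j), (j - Q k).
have /asboolP[ge _] := fW (Q k); rewrite !mulnBl -fj.
have : f j * a <= i * a by rewrite leq_mul2r fi orbT.
have : Q k * b <= j * b by rewrite leq_mul2r Qk orbT.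
by move: ge; rewrite -fj; lia.
Qed.

Section Corners.
Variables (n : nat) (P Q e : nat -> nat).
Hypothesis PQ : staircase n P Q.
Hypothesis eE : forall k, k <= n -> e k + a * b = e 0 + P k * a + Q k * b.

(** The corner (P_k, Q_(k+1)) between two consecutive corners of the path, reflected
through the center of the rectangle of size b by a. *)
Definition dual_corner k := (b - P k) * a + (a - Q k.+1) * b.

Lemma staircase_lt k l : k < l -> l <= n -> P l < P k /\ Q k < Q l.
Proof.
have [_ _ _ _ st] := PQ.
elim: l => // l IH; rewrite ltnS leq_eqVlt => /orP[/eqP->|kl] ln.
  exact: st.
by have := IH kl (ltnW ln); have := st l ln; lia.
Qed.

Lemma staircase_le k l : k <= l -> l <= n -> P l <= P k /\ Q k <= Q l.
Proof.
rewrite leq_eqVlt => /orP[/eqP->//|kl ln].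
by have [? ?] := staircase_lt kl ln; split; apply: ltnW.
Qed.

Lemma staircase_bounds k : k <= n -> P k <= b /\ Q k <= a.
Proof.
have [P0 _ _ Qn _] := PQ => kn.
have := staircase_le (leq0n k) kn; have := staircase_le kn (leqnn n).
by rewrite P0 Qn; lia.
Qed.

Lemma staircase_n_gt0 : 0 < n.
Proof. have [P0 Pn _ _ _] := PQ; rewrite lt0n; apply/eqP => n0.
by move: Pn; rewrite n0 P0; lia. Qed.

Lemma staircase_inner k : k < n -> 0 < P k /\ Q k < a.
Proof.
by have [_ Pn _ Qn _] := PQ => kn; have := staircase_lt kn (leqnn n); rewrite Pn Qn.
Qed.

Lemma corner_last : e n = e 0.
Proof. by have [_ Pn _ Qn _] := PQ; have := eE (leqnn n); rewrite Pn Qn; lia. Qed.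

Lemma corner_irredundant k l s : k < n -> l < n -> semigroup s ->
  e k = e l + s -> k = l.
Proof.
move=> kn ln [i [j ->]] E.
have [Pk Qk] := staircase_inner kn; have [Pl _] := staircase_inner ln.
have [Pk' _] := staircase_bounds (ltnW kn).
have [|c [Qc Pc]] := @semigroup_rep_unique (P k) (Q k) (P l + i) (Q l + j) Qk.
  by have := eE (ltnW kn); have := eE (ltnW ln); rewrite !mulnDl; lia.
have c0 : c = 0 by case: c Pc {Qc} => // c; nia.
rewrite c0 !mul0n !addn0 in Qc Pc.
case: (ltngtP k l) => // [kl|lk].
  by have := staircase_lt kl (ltnW ln); lia.
by have := staircase_lt lk (ltnW kn); lia.
Qed.

Lemma dual_corner_irredundant k l s : k < n -> l < n -> semigroup s ->
  dual_corner k = dual_corner l + s -> k = l.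
Proof.
move=> kn ln [i [j ->]]; rewrite /dual_corner => E.
have [Pk _] := staircase_inner kn; have [Pk' _] := staircase_bounds (ltnW kn).
have [Pl' _] := staircase_bounds (ltnW ln).
have [Qk _] := staircase_lt (ltn0Sn k) kn; have [_ Q'k] := staircase_bounds kn.
have [_ Q'l] := staircase_bounds ln.
have Q0 : Q 0 < Q k.+1 by have [] := staircase_lt (ltn0Sn k) kn.
have [||c [Qc Pc]] := @semigroup_rep_unique (b - P k) (a - Q k.+1)
  (b - P l + i) (a - Q l.+1 + j); [by lia | by rewrite E !mulnDl; lia |].
have c0 : c = 0 by case: c Pc {Qc} => // c; nia.
rewrite c0 !mul0n !addn0 in Qc Pc.
case: (ltngtP k l) => // [kl|lk].
  by have := staircase_lt kl (ltnW ln); lia.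
by have := @staircase_lt l.+1 k.+1 lk kn; lia.
Qed.

Lemma dual_corner_add k l : k < n -> l <= n ->
  dual_corner k + e l + Q k.+1 * b + P k * a = e 0 + a * b + P l * a + Q l * b.
Proof.
move=> kn ln; have [Pk _] := staircase_bounds (ltnW kn).
have [_ Qk] := staircase_bounds kn; have := eE ln.
rewrite /dual_corner !mulnBl.
have : P k * a <= b * a by rewrite leq_mul2r Pk orbT.
have : Q k.+1 * b <= a * b by rewrite leq_mul2r Qk orbT.
by lia.
Qed.

Lemma dual_corner_add_same k : k < n ->
  dual_corner k + e k = e 0 + (a - (Q k.+1 - Q k)) * b.
Proof.
move=> kn; have := dual_corner_add kn (ltnW kn).
have [_ Qk] := staircase_lt (ltnSn k) kn; have [_ Q'k] := staircase_bounds kn.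
rewrite !mulnBl.
have : Q k.+1 * b <= a * b by rewrite leq_mul2r Q'k orbT.
have : Q k * b <= Q k.+1 * b by rewrite leq_mul2r (ltnW Qk) orbT.
by lia.
Qed.

Lemma dual_corner_add_next k : k < n ->
  dual_corner k + e k.+1 = e 0 + (b - (P k - P k.+1)) * a.
Proof.
move=> kn; have := dual_corner_add kn kn.
have [Pk _] := staircase_lt (ltnSn k) kn; have [P'k _] := staircase_bounds (ltnW kn).
rewrite !mulnBl.
have : P k * a <= b * a by rewrite leq_mul2r P'k orbT.
have : P k.+1 * a <= P k * a by rewrite leq_mul2r (ltnW Pk) orbT.
by lia.
Qed.

Lemma dual_corner_addP k l : k < n -> l < n ->
  exists2 s, semigroup s & dual_corner k + e l = e 0 + s.
Proof.
move=> kn ln; have := dual_corner_add kn (ltnW ln).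
have [Pk _] := staircase_bounds (ltnW kn); have [_ Qk] := staircase_bounds kn.
have Pkb : P k * a <= b * a by rewrite leq_mul2r Pk orbT.
have Qka : Q k.+1 * b <= a * b by rewrite leq_mul2r Qk orbT.
have [lk|kl] := leqP l k => E.
  have [Plk _] := staircase_le lk (ltnW kn).
  have : P k * a <= P l * a by rewrite leq_mul2r Plk orbT.
  exists ((P l - P k) * a + (a - Q k.+1 + Q l) * b); first by eexists; eexists.
  by rewrite mulnDl !mulnBl; lia.
have [_ Qlk] := staircase_le kl (ltnW ln).
have : Q k.+1 * b <= Q l * b by rewrite leq_mul2r Qlk orbT.
exists ((b - P k + P l) * a + (Q l - Q k.+1) * b); first by eexists; eexists.
by rewrite mulnDl !mulnBl; lia.
Qed.

(** Duality of staircases.  Write s = i a + j b with j < a and choose the step k with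
Q_k < a - j <= Q_(k+1).  Since j + Q_k < a, the condition at the single corner k
already forces i + P_k >= b, so s lies above [dual_corner k]. *)
Lemma dual_cornerP s :
  (forall l, l < n -> exists2 s', semigroup s' & s + e l = e 0 + s') <->
  exists2 k, k < n & exists2 s', semigroup s' & s = dual_corner k + s'.
Proof.
have [_ _ Q0 Qn st] := PQ.
split=> [sE|[k kn [s' Ss' ->]] l ln]; last first.
  have [s'' Ss'' hE] := dual_corner_addP kn ln.
  by exists (s' + s''); [apply: semigroupD | lia].
have [i [j [ja sij]]] : exists i j, j < a /\ s = i * a + j * b.
  have [_ [i [j ->]]] := sE 0 staircase_n_gt0; rewrite addnC => /addnI->.
  exists (i + j %/ a * b), (j %% a); rewrite ltn_mod; split=> //.
  by rewrite {1}(divn_eq j a); lia.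
have [k [kn Qk jQ]] : exists k, [/\ k < n, Q k < a - j & a - j <= Q k.+1].
  have : a - j <= Q n by rewrite Qn leq_subr.
  have : 0 < a - j by rewrite subn_gt0.
  have {}st k : k < n -> Q k < Q k.+1 by move=> /st[].
  move: (a - j) Q0 st => c; elim: (n) => [|n' IH] Q0 st c0 cQ; first by exfalso; lia.
  have [cQ'|Qc] := leqP c (Q n'); last by exists n'.
  have [||||k [kn ? ?]] := IH => //; first by move=> k kn; apply/st/ltnW.
  by exists k; split=> //; apply: ltnW.
have [s' [i' [j' ->]] sk] := sE k kn.
have [||c [jc ic]] := @semigroup_rep_unique (i + P k) (j + Q k) (b + i') j'.
- by lia.
- by have := eE (ltnW kn); rewrite !mulnDl; lia.
have [Pk _] := staircase_bounds (ltnW kn); have [_ Q'k] := staircase_bounds kn.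
exists k => //; exists ((i - (b - P k)) * a + (j - (a - Q k.+1)) * b).
  by exists (i - (b - P k)), (j - (a - Q k.+1)).
have iE : i = (b - P k) + (i - (b - P k)) by lia.
have jE : j = (a - Q k.+1) + (j - (a - Q k.+1)) by lia.
by rewrite {1}sij {1}iE {1}jE /dual_corner; lia.
Qed.

End Corners.
End Staircase.

(** * Minimal generation tested modulo a proper ideal *)

Lemma linear_morphE (R : comNzRingType) (M N : lmodType R) (f : M -> N) :
  linear f -> [/\ f 0 = 0, forall r y, f (r *: y) = r *: f y
                & {morph f : y z / y + z}].
Proof.
move=> fL; have f0 : f 0 = 0.
  by have := fL (-1) 0 0; rewrite scaler0 addr0 scaleN1r addNr.
by split=> // [r y|y z]; [have := fL r y 0; rewrite f0 !addr0
                         |have := fL 1 y z; rewrite !scale1r].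
Qed.

Section Families.
Variables (R : comNzRingType) (M : lmodType R).

Lemma span_familyP (T : finType) (x : T -> M) y :
  lin_span (range x) y <-> exists c : T -> R, y = \sum_i c i *: x i.
Proof.
split=> [[s sx ->]|[c ->]].
  elim: s sx => [|p s IH] sx.
    by exists (fun=> 0); rewrite big_nil big1 // => i _; rewrite scale0r.
  have [|c cE] := IH; first by move=> q qs; apply: sx; rewrite inE qs orbT.
  have [j _ xj] : range x p.2 by apply: sx; rewrite mem_head.
  exists (fun i => (if i == j then p.1 else 0) + c i).
  rewrite big_cons cE; under [RHS]eq_bigr do rewrite scalerDl.
  rewrite big_split /=; congr (_ + _); rewrite (bigD1 j) //= eqxx xj big1 ?addr0 //.
  by move=> i /negPf->; rewrite scale0r.
have spanS (s : seq T) : lin_span (range x) (\sum_(i <- s) c i *: x i).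
  elim: s => [|i s IH]; first by rewrite big_nil; apply: Defs.span0.
  rewrite big_cons; apply: Defs.spanD => //.
  by apply/Defs.spanZ/Defs.sub_span; exists i.
exact: spanS.
Qed.

Lemma set_of_image (T : finType) (x : T -> M) :
  [set` [seq x i | i : T]] = range x.
Proof.
apply/seteqP; split=> y /=; first by move/mapP=> [i _ ->]; exists i.
by case=> i _ <-; apply/mapP; exists i; rewrite // mem_enum.
Qed.

Lemma set_of_nth (s : seq M) : [set` s] = range (fun i : 'I_(size s) => s`_i).
Proof.
apply/seteqP; split=> y /=; last by case=> i _ <-; apply: mem_nth.
move/(nthP 0)=> [i si <-]; by exists (Ordinal si).
Qed.

Lemma generates_imageP (T : finType) (x : T -> M) :
  generates [seq x i | i : T] <->
  forall y, exists c : T -> R, y = \sum_i c i *: x i.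
Proof.
rewrite /generates set_of_image; split=> [xT y|xT].
  by apply/span_familyP; rewrite xT.
by apply/seteqP; split=> // y _; apply/span_familyP.
Qed.

Lemma generatesP (s : seq M) : generates s ->
  forall y, exists c : 'I_(size s) -> R, y = \sum_i c i *: s`_i.
Proof.
by rewrite /generates set_of_nth => sT y; apply/span_familyP; rewrite sT.
Qed.

Lemma lin_span_sub (G H : set M) y :
  (forall z, G z -> lin_span H z) -> lin_span G y -> lin_span H y.
Proof.
move=> GH [r rG ->]; elim: r rG => [|p r IH] rG.
  by rewrite big_nil; apply: Defs.span0.
rewrite big_cons; apply: Defs.spanD.
  by apply/Defs.spanZ/GH/rG; rewrite mem_head.
by apply: IH => q qr; apply: rG; rewrite inE qr orbT.
Qed.

Lemma mu_le (s : seq M) : generates s -> (mu M <= size s)%N.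
Proof.
move=> sM; rewrite /mu; case: pselect => // P; case: ex_minnP => n _; apply.
by apply/asboolP; exists s.
Qed.

Variable m : idealr R.

(** For a generating family this amounts to independence modulo mM: an element of mM
has an expression with coefficients in m, which can be subtracted. *)
Definition irredundant_mod (T : finType) (x : T -> M) : Prop :=
  forall c : T -> R, \sum_i c i *: x i = 0 -> forall i, c i \in m.

Lemma pi_eq0 (r : R) : r \in m -> \pi_{ideal_quot m} r = 0.
Proof.
move=> rm; apply/eqP; rewrite -(rmorph0 \pi_{ideal_quot m}) -Quotient.idealrBE.
by rewrite subr0.
Qed.

Lemma pi_eq0P (r : R) : \pi_{ideal_quot m} r = 0 -> r \in m.
Proof.
rewrite -[0](rmorph0 \pi_{ideal_quot m}) => /eqP; rewrite -Quotient.idealrBE.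
by rewrite subr0.
Qed.

(** Writing the two families in terms of each other gives matrices whose product is
the identity modulo m, and over the nonzero ring R / m such a product bounds #|T| by
the inner dimension. *)
Lemma irredundant_size (T : finType) (x : T -> M) (s : seq M) :
  irredundant_mod x -> generates [seq x i | i : T] -> generates s ->
  (#|T| <= size s)%N.
Proof.
move=> irr /generates_imageP/(_ s`_ _) xM /generatesP sM.
have [c cE] := choice (fun i => sM (x i)).
have [d dE] := choice (fun i : 'I_(size s) => xM i).
pose C := \matrix_(i < #|T|, j < size s) c (enum_val i) j.
pose D := \matrix_(j < size s, i < #|T|) d j (enum_val i).
pose pi_mx n p := @map_mx _ _ \pi_{ideal_quot m} n p.
apply: (@mulmx1_min _ _ _ (pi_mx _ _ C) (pi_mx _ _ D)); rewrite {}/pi_mx.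
rewrite -map_mxM; apply/matrixP => i k; rewrite !mxE.
have rel i0 : \sum_i (\sum_j c i0 j * d j i - (i == i0)%:R) *: x i = 0.
  under eq_bigr do rewrite scalerBl scaler_suml.
  rewrite sumrB exchange_big /= [X in _ - X](bigD1 i0) //= eqxx scale1r.
  rewrite [X in _ - (_ + X)]big1 ?addr0 => [|i' /negPf->]; last by rewrite scale0r.
  rewrite [x i0]cE; apply/eqP; rewrite subr_eq0; apply/eqP/eq_bigr => j _.
  by rewrite dE scaler_sumr; apply: eq_bigr => i' _; rewrite scalerA.
have := irr _ (rel (enum_val i)) (enum_val k) => /pi_eq0.
rewrite rmorphB => /eqP; rewrite subr_eq0 => /eqP piE.
rewrite (eq_bigr (fun j => c (enum_val i) j * d j (enum_val k))) => [|j _]; last first.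
  by rewrite !mxE.
by rewrite piE rmorph_nat (inj_eq enum_val_inj) eq_sym.
Qed.

(** Subtracting from members of an irredundant generating family multiples of members
that are left alone is invertible; this is how torsion generators are produced. *)
Lemma minimal_generating_torsion (T : finType) (x : T -> M) (Z : {set T})
    (base : T -> T) (c : T -> R) :
  irredundant_mod x -> generates [seq x i | i : T] ->
  (forall i, c (base i) = 0) ->
  (forall i, i \in Z -> torsion (x i - c i *: x (base i))) ->
  exists s : seq M, minimal_generating s /\
    (#|Z| <= count (fun y => `[< torsion y >]) s)%N.
Proof.
move=> irr xM c0 Ztors; pose x' i := x i - c i *: x (base i).
have x'M : generates [seq x' i | i : T].
  rewrite /generates set_of_image; apply/seteqP; split=> // y _.
  have : lin_span (range x) y by rewrite -set_of_image xM.
  apply: lin_span_sub => _ [i _ <-].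
  have -> : x i = x' i + c i *: x' (base i).
    by rewrite /x' c0 scale0r subr0 subrK.
  by apply: Defs.spanD; [|apply: Defs.spanZ]; apply: Defs.sub_span; eexists.
exists [seq x' i | i : T]; split.
  by split=> // s sM; rewrite size_image; apply: irredundant_size irr xM sM.
rewrite count_map -size_filter.
rewrite cardE; apply: uniq_leq_size => [|i]; first exact: enum_uniq.
rewrite mem_enum mem_filter mem_enum => iZ /=; rewrite andbT.
exact/asboolP/Ztors.
Qed.

End Families.

Section ResidueModule.
Variables (R : comNzRingType) (m : idealr R).

(** R / m under a name of its own, to carry the structure of an R-module. *)
Definition residue := {ideal_quot m}.
HB.instance Definition _ := GRing.Zmodule.on residue.

Definition residue_scale (r : R) (y : residue) : residue :=
  (\pi_{ideal_quot m} r * (y : {ideal_quot m}))%R.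

Let scaleA r s y : residue_scale r (residue_scale s y) = residue_scale (r * s) y.
Proof. by rewrite /residue_scale rmorphM mulrA. Qed.
Let scale1 : left_id 1 residue_scale.
Proof. by move=> y; rewrite /residue_scale rmorph1 mul1r. Qed.
Let scaleDr : right_distributive residue_scale +%R.
Proof. by move=> r y z; rewrite /residue_scale; apply: mulrDr. Qed.
Let scaleDl y : {morph residue_scale^~ y : r s / r + s}.
Proof. by move=> r s; rewrite /residue_scale rmorphD; apply: mulrDl. Qed.

HB.instance Definition _ :=
  GRing.Zmodule_isLmodule.Build R residue scaleA scale1 scaleDr scaleDl.

Lemma residue_scaleE r (y : residue) :
  r *: y = (\pi_{ideal_quot m} r * (y : {ideal_quot m}))%R :> {ideal_quot m}.
Proof. by []. Qed.

(** Two expressions of the same element differ by a relation, hence have equal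
coefficients modulo m: coordinates with values in R / m are well defined. *)
Lemma coordinate_mod (M : lmodType R) (T : finType) (x : T -> M) i0 :
  irredundant_mod m x -> generates [seq x i | i : T] ->
  exists2 f : M -> residue, linear f &
    forall i, f (x i) = \pi_{ideal_quot m} (i == i0)%:R :> {ideal_quot m}.
Proof.
move=> irr /generates_imageP xM; have [c cE] := choice xM.
have piE d y : y = \sum_i d i *: x i ->
    \pi_{ideal_quot m} (c y i0) = \pi_{ideal_quot m} (d i0).
  move=> yE; apply/eqP; rewrite -subr_eq0 -rmorphB; apply/eqP/pi_eq0.
  apply: (irr (fun i => c y i - d i)).
  by under eq_bigr do rewrite scalerBl; rewrite sumrB -cE -yE subrr.
exists (fun y => \pi_{ideal_quot m} (c y i0)) => [r y z|i].
  rewrite (piE (fun i => r * c y i + c z i)); first by rewrite rmorphD rmorphM.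
  under eq_bigr do rewrite scalerDl -scalerA.
  by rewrite big_split /= -scaler_sumr -!cE.
rewrite (piE (fun j => (i == j)%:R)) // (bigD1 i) //= eqxx scale1r big1 ?addr0 //.
by move=> j; rewrite eq_sym => /negPf->; rewrite scale0r.
Qed.

End ResidueModule.

Section TensorFamilies.
Variables (R : comNzRingType) (M N : lmodType R) (T U : finType).
Variables (x : T -> M) (y : U -> N).
Hypotheses (xM : generates [seq x i | i : T]) (yN : generates [seq y j | j : U]).

Definition tens_family (p : T * U) : tensor M N := tens (x p.1) (y p.2).

Lemma tens0l z : tens (0 : M) (z : N) = 0.
Proof. by rewrite -(scale0r 0) tensZl scale0r. Qed.
Lemma tens0r w : tens (w : M) (0 : N) = 0.
Proof. by rewrite -(scale0r 0) tensZr scale0r. Qed.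

Lemma tens_suml (I : finType) (F : I -> M) (z : N) :
  tens (\sum_i F i) z = \sum_i tens (F i) z.
Proof.
exact: (big_morph (fun w => tens w z) (fun _ _ => tensDl _ _ _) (tens0l z)).
Qed.

Lemma tens_sumr (I : finType) (F : I -> N) (w : M) :
  tens w (\sum_i F i) = \sum_i tens w (F i).
Proof. exact: (big_morph (tens w) (tensDr w) (tens0r w)). Qed.

Lemma generates_tens : generates [seq tens_family p | p : T * U].
Proof.
have xM' := (generates_imageP x).1 xM; have yN' := (generates_imageP y).1 yN.
rewrite /generates set_of_image; apply/seteqP; split=> // z _.
elim/quotW: z => s; rewrite pi_tensorE.
elim: s => [|[w z] s IH]; first by rewrite big_nil; apply: Defs.span0.
rewrite big_cons; apply: Defs.spanD => //=; apply/span_familyP.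
have [c ->] := xM' w; have [d ->] := yN' z.
exists (fun p => c p.1 * d p.2); rewrite tens_suml.
rewrite -(pair_bigA _ (fun i j => (c i * d j) *: tens_family (i, j))) /=.
apply: eq_bigr => i _; rewrite tens_sumr; apply: eq_bigr => j _.
by rewrite tensZl tensZr scalerA.
Qed.

(** The product of a coordinate of M and one of N is bilinear, so it defines a form
on the tensor product which isolates a single coefficient of a relation. *)
Lemma irredundant_tens (m : idealr R) :
  irredundant_mod m x -> irredundant_mod m y -> irredundant_mod m tens_family.
Proof.
move=> irx iry c rel [i0 j0].
have [f fL fx] := coordinate_mod i0 irx xM.
have [g gL gy] := coordinate_mod j0 iry yN.
pose K : comNzRingType := {ideal_quot m}.
pose pi (r : R) : K := \pi_{ideal_quot m} r.
pose F w z : residue m := (f w : K) * (g z : K).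
have [|| h [[hL hF] _]] := @tensor_universal R M N (residue m) F.
- move=> z r w w'; rewrite /F fL.
  change ((pi r * f w + f w' : K) * g z = pi r * (f w * g z : K) + f w' * g z :> K).
  by rewrite mulrDl mulrA.
- move=> w r z z'; rewrite /F gL.
  change ((f w : K) * (pi r * g z + g z') = pi r * (f w * g z : K) + f w * g z' :> K).
  by rewrite mulrDr mulrCA.
have [h0 hZ hD] := linear_morphE hL.
have := congr1 h rel; rewrite h0 (big_morph h hD h0) (bigD1 (i0, j0)) //= big1.
  rewrite addr0 hZ hF /F fx gy !eqxx residue_scaleE rmorph1 !mulr1.
  exact: pi_eq0P.
case=> i j; rewrite xpair_eqE negb_and hZ hF residue_scaleE /F /= fx gy.
by case/orP=> /negPf->; rewrite rmorph0 ?mul0r !mulr0.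
Qed.

End TensorFamilies.

(** * Torsion in the tensor product of an ideal with its dual *)

Section IdealDual.
Variables (R : comNzRingType) (I : submodClosed R^o).

Definition dual_elt (f : submod I -> R^o) (lf : linear f) : dual_module (submod I) :=
  exist _ f (introT (asboolP _) lf).

Lemma dual_linear (f : dual_module (submod I)) : linear (val f).
Proof. by apply/asboolP; apply: (valP f). Qed.

Lemma dual_scale (f : dual_module (submod I)) (r : R) y :
  val f (r *: y) = r * val f y :> R.
Proof. by have [_ fZ _] := linear_morphE (dual_linear f); apply: fZ. Qed.

(** Both sides are the value at the product of x and y, both being elements of R. *)
Lemma dual_swap (f : dual_module (submod I)) (x y : submod I) :
  val x * val f y = val y * val f x :> R.
Proof.
rewrite -!dual_scale; congr (val f _); apply: val_inj.
by rewrite /= [LHS]mulrC.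
Qed.

Lemma dual_valZ (f : dual_module (submod I)) (r : R) y :
  val (r *: f) y = r * val f y :> R.
Proof.
have -> : val (r *: f) = r *: val f; last by [].
exact: (linearZ_LR (val : submod (@linear_forms R (submod I)) -> _)).
Qed.

Lemma dual_valD (f g : dual_module (submod I)) y :
  val (f + g) y = val f y + val g y.
Proof. by []. Qed.

Lemma dual_val0 y : val (0 : dual_module (submod I)) y = 0.
Proof. by rewrite -(scale0r 0) dual_valZ mul0r. Qed.

Lemma dual_val_sum (K : finType) (F : K -> dual_module (submod I)) y :
  val (\sum_k F k) y = \sum_k val (F k) y.
Proof.
exact: (big_morph (fun f : dual_module (submod I) => val f y)
  (fun f g => dual_valD f g y) (dual_val0 y)).
Qed.

Lemma val_inclusion_linear : linear (fun y : submod I => val y : R^o).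
Proof. by []. Qed.

(** Multiplication by x0 sends y (x) f to f(y) (x0 (x) iota), with iota the inclusion
of I in R: move y, an element of R, across the tensor sign and apply [dual_swap].
So, up to torsion, a pure tensor is determined by the value of the form. *)
Lemma torsion_tens (x0 x x' : submod I) (g g' : dual_module (submod I)) (r : R) :
  val x0 != 0 -> val g x = r * val g' x' ->
  torsion (tens x g - r *: tens x' g').
Proof.
move=> x0_neq0 gE; exists (val x0) => //.
have tensE (y : submod I) (f : dual_module (submod I)) :
      (val x0 : R) *: tens y f =
      (val f y : R) *: tens x0 (dual_elt val_inclusion_linear).
  have -> : (val x0 : R) *: tens y f = (val y : R) *: tens x0 f.
    by rewrite -!tensZl; congr tens; apply: val_inj; rewrite /= [LHS]mulrC.
  rewrite -!tensZr; congr tens; apply: val_inj; apply/funext => z.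
  by rewrite !dual_valZ dual_swap mulrC.
rewrite scalerBr scalerA mulrC -scalerA !tensE scalerA -gE.
by rewrite subrr.
Qed.

End IdealDual.

(** * Ideals generated by powers of t *)

Section Expansions.
Variables (R : comNzRingType) (A : idomainType) (emb : {rmorphism R -> A}) (t : A).

(** Elements of R[t] with an expansion supported in degrees satisfying T. *)
Inductive expansion (T : nat -> Prop) : A -> Prop :=
| expansion0 : expansion T 0
| expansionS r j y : T j -> expansion T y -> expansion T (emb r * t ^+ j + y).

Lemma expansion1 (T : nat -> Prop) r j : T j -> expansion T (emb r * t ^+ j).
Proof.
by move=> Tj; rewrite -[_ * _]addr0; apply: expansionS => //; apply: expansion0.
Qed.

Lemma expansionD (T : nat -> Prop) y z :
  expansion T y -> expansion T z -> expansion T (y + z).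
Proof.
move=> Ty Tz; elim: Ty => [|r j {}y Tj _ IH]; first by rewrite add0r.
by rewrite -addrA; apply: expansionS.
Qed.

Lemma expansion_mul (T T' : nat -> Prop) r j y : (forall i, T i -> T' (j + i)%N) ->
  expansion T y -> expansion T' (emb r * t ^+ j * y).
Proof.
move=> TT'; elim=> [|s i {}y Ti _ IH]; first by rewrite mulr0; apply: expansion0.
rewrite mulrDr mulrACA -rmorphM -exprD; apply: expansionS => //; exact: TT'.
Qed.

Lemma expansion_sub (T T' : nat -> Prop) y : (forall i, T i -> T' i) ->
  expansion T y -> expansion T' y.
Proof.
by move=> TT'; elim=> [|r j {}y /TT' Tj _]; [apply: expansion0|apply: expansionS].
Qed.

Lemma expansionN (T : nat -> Prop) y : expansion T y -> expansion T (- y).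
Proof.
move=> Ty; have := expansion_mul (-1) (j := 0) (fun _ => id) Ty.
by rewrite mulr1 rmorphN1 mulN1r.
Qed.

Lemma expansionB (T : nat -> Prop) y z :
  expansion T y -> expansion T z -> expansion T (y - z).
Proof. by move=> Ty /expansionN; apply: expansionD. Qed.

Lemma expansion_sum (T : nat -> Prop) (K : finType) (p : pred K) (F : K -> A) :
  (forall k, p k -> expansion T (F k)) -> expansion T (\sum_(k | p k) F k).
Proof.
by move=> TF; apply: big_ind => //; [apply: expansion0|apply: expansionD].
Qed.

Lemma expansion_split (T : nat -> Prop) j y :
  expansion (fun i => T i /\ (j <= i)%N) y ->
  exists c y', [/\ c = 0 \/ T j, expansion (fun i => T i /\ (j < i)%N) y'
                 & y = emb c * t ^+ j + y'].
Proof.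
elim=> [|r i {}y [Ti ji] _ [c [y' [cT Ty' ->]]]].
  by exists 0, 0; rewrite rmorph0 mul0r addr0; split; [left|exact: expansion0|].
move: ji; rewrite leq_eqVlt => /orP[/eqP ji|ji]; last first.
  exists c, (emb r * t ^+ i + y'); split=> //; first exact: expansionS.
  by rewrite addrCA.
exists (r + c), y'; split=> //; first by right; rewrite ji.
by rewrite -ji addrA -mulrDl -rmorphD.
Qed.

Lemma expansion_family (K : finType) (d : K -> nat) (S T : nat -> Prop) y :
  (forall s, S s -> exists r, emb r = t ^+ s) ->
  (forall s, T s -> exists k, exists2 s', S s' & s = (d k + s')%N) ->
  expansion T y -> exists c : K -> R, y = \sum_k emb (c k) * t ^+ d k.
Proof.
move=> Semb Td; elim=> [|r j {}y /Td[k [s /Semb[w wE] ->]] _ [c ->]].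
  by exists (fun=> 0); rewrite big1 // => k _; rewrite rmorph0 mul0r.
exists (fun l => (if l == k then r * w else 0) + c l).
under [RHS]eq_bigr do rewrite rmorphD mulrDl.
rewrite big_split /=; congr (_ + _); rewrite (bigD1 k) //= eqxx big1 ?addr0.
  by rewrite rmorphM wE exprD -!mulrA [t ^+ s * _]mulrC.
by move=> l /negPf->; rewrite rmorph0 mul0r.
Qed.

Hypothesis t_neq0 : t != 0.
Variables (a b : nat) (u v : R) (m : idealr R).
Hypotheses (a_gt0 : (0 < a)%N) (b_gt0 : (0 < b)%N) (coprime_ab : coprime a b).
Hypotheses (embu : emb u = t ^+ a) (embv : emb v = t ^+ b).
(** [m_gen] lets a term with coefficient in m move to higher degrees, and [m_max]
recognizes such a coefficient by its divisibility by t. *)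
Hypothesis m_gen : forall r, r \in m -> exists r1 r2, r = r1 * u + r2 * v.
Hypothesis m_max : forall r, expansion (fun i => (0 < i)%N) (emb r) -> r \in m.

Lemma expansion_lead d c : expansion (fun i => (d < i)%N) (emb c * t ^+ d) -> c \in m.
Proof.
move=> cd; apply: m_max.
have [z [zE Tz]] : exists z,
    emb c * t ^+ d = t ^+ d * z /\ expansion (fun i => (0 < i)%N) z.
  elim: cd => [|r j y dj _ [z [-> Tz]]].
    by exists 0; rewrite mulr0; split=> //; apply: expansion0.
  exists (emb r * t ^+ (j - d) + z); split; last by apply: expansionS; rewrite ?subn_gt0.
  by rewrite mulrDr mulrCA -exprD subnKC // ltnW.
by move: zE; rewrite mulrC => /(mulfI (expf_neq0 d t_neq0))->.
Qed.

(** A leading term in a degree d outside T has its coefficient in m.  Sweep the given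
expansion from degree 0 up to d: the coefficient of the least degree j < d is
divisible by t, hence in m = (u, v), so this term can be rewritten in degrees j + a
and j + b.  What remains starts after d, as d is not in T. *)
Lemma expansion_mem_lead (T : nat -> Prop) c d z :
  (forall s, T s -> T (s + a)%N) -> (forall s, T s -> T (s + b)%N) ->
  expansion T (emb c * t ^+ d + z) -> expansion (fun i => (d < i)%N) z ->
  ~ T d -> c \in m.
Proof.
move=> Ta Tb; set y := _ + z => Ty dz nTd.
have {Ty} : expansion (fun i => T i /\ (d <= i)%N) y.
  suff H j : (j <= d)%N -> expansion (fun i => T i /\ (j <= i)%N) y by apply: H.
  elim: j => [_|j IH jd]; first by apply: expansion_sub Ty.
  case/expansion_split: (IH (ltnW jd)) => c' [y' [c'T Ty' yE]]; rewrite yE.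
  apply: expansionD => //.
  have c'm : c' \in m.
    apply: (@expansion_lead j); have -> : emb c' * t ^+ j = y - y' by rewrite yE addrK.
    apply: expansionB; last by apply: expansion_sub Ty' => i [].
    apply: expansionD; first exact: expansion1.
    by apply: expansion_sub dz => i; apply: ltn_trans.
  case: c'T => [->|Tj]; first by rewrite rmorph0 mul0r; apply: expansion0.
  have [r1 [r2 ->]] := m_gen c'm.
  rewrite rmorphD !rmorphM embu embv mulrDl -!mulrA -!exprD ![(_ + j)%N]addnC.
  apply: expansionS; [|apply: expansion1]; split; [exact: Ta|lia|exact: Tb|lia].
case/expansion_split=> c' [y' [[c0|//] Ty']]; rewrite c0 rmorph0 mul0r add0r => yE.
apply: (@expansion_lead d); have -> : emb c * t ^+ d = y' - z by rewrite -yE addrK.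
by apply: expansionB => //; apply: expansion_sub Ty' => i [].
Qed.

Notation S := (semigroup a b).

Lemma semigroup_emb s : S s -> exists r, emb r = t ^+ s.
Proof.
move=> [i [j ->]]; exists (u ^+ i * v ^+ j).
rewrite rmorphM !rmorphXn embu embv exprD -!exprM.
by rewrite ![(_ * a)%N]mulnC ![(_ * b)%N]mulnC.
Qed.

(** In a relation, the k-th term has an expansion supported in the semigroup ideal of
the other exponents, which does not contain d k. *)
Lemma powers_irredundant (K : finType) (d : K -> nat) (c : K -> R) :
  (forall k l s, S s -> d k = (d l + s)%N -> k = l) ->
  \sum_k emb (c k) * t ^+ d k = 0 -> forall k, c k \in m.
Proof.
move=> irr rel k.
pose T s := exists2 l, l != k & exists2 s', S s' & s = (d l + s')%N.
have TD s s' : S s' -> T s -> T (s + s')%N.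
  move=> Ss' [l lk [s'' Ss'' ->]]; exists l => //.
  by exists (s'' + s')%N; [apply: semigroupD|rewrite addnA].
apply: (@expansion_mem_lead T (c k) (d k) 0).
- by move=> s; apply: TD; apply: semigroup_a.
- by move=> s; apply: TD; apply: semigroup_b.
- move: rel; rewrite (bigD1 k) //= => /eqP; rewrite addr_eq0 => /eqP->; rewrite addr0.
  apply/expansionN/expansion_sum => l lk; apply: expansion1.
  by exists l => //; exists 0%N; rewrite ?addn0 //; apply: semigroup0.
- exact: expansion0.
- by move=> [l lk [s Ss /(irr _ _ _ Ss) kl]]; rewrite kl eqxx in lk.
Qed.

Hypothesis emb_inj : injective emb.

Section Ideal.
Variable I : submodClosed R^o.
Hypothesis I_mon : monomial_ideal emb t I.

Let E s := exists2 y : R, y \in (I : {pred R^o}) & emb y = t ^+ s.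

Lemma ideal_staircase : exists n P Q e (x : 'I_n -> submod I),
  [/\ staircase a b n P Q,
      forall k, (k <= n)%N -> (e k + a * b = e 0 + P k * a + Q k * b)%N,
      forall k, emb (val (x k)) = t ^+ e k
    & generates [seq x k | k : 'I_n]].
Proof.
have [[r0 r0I r0_neq0] [G GE IG]] := I_mon.
have GI g : G g -> g \in (I : {pred R^o}).
  by move=> Gg; have : [set` I] g by rewrite IG; apply: Defs.sub_span.
have mulI r y : y \in (I : {pred R^o}) -> r * y \in (I : {pred R^o}).
  exact: rpredZ.
have [|s [w wI wE]|s [w wI wE]|n [P [Q [e [PQ eE EE]]]]] :=
  @staircase_exists a b a_gt0 b_gt0 coprime_ab E.
- have : [set` I] r0 by [].
  rewrite IG => -[[|p s] sG r0E]; first by rewrite r0E big_nil eqxx in r0_neq0.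
  have Gp : G p.2 by apply: sG; rewrite mem_head.
  by have [n pn] := GE _ Gp; exists n, p.2 => //; apply: GI.
- by exists (u * w); [exact: mulI|rewrite rmorphM embu wE exprD mulrC].
- by exists (v * w); [exact: mulI|rewrite rmorphM embv wE exprD mulrC].
have Ee (k : 'I_n) : exists x : submod I, emb (val x) = t ^+ e k.
  have [y yI yE] : E (e k); last by exists (exist _ y yI).
  apply/EE; exists k => //; exists 0%N; rewrite ?addn0 //; exact: semigroup0.
have [x xE] := choice Ee; exists n, P, Q, e, x; split=> //.
apply/generates_imageP => y.
have : lin_span (M := R^o) (range (fun k => val (x k))) (val y).
  have : [set` I] (val y) by apply: valP.
  rewrite IG; apply: lin_span_sub => g Gg; have [s gs] := GE g Gg.
  have [|k kn [s' Ss' sE]] := (EE s).1; first by exists g => //; apply: GI.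
  have [w wE] := semigroup_emb Ss'.
  have -> : g = w *: (val (x (Ordinal kn)) : R^o).
    by apply: emb_inj; rewrite rmorphM wE xE gs sE exprD mulrC.
  by apply/Defs.spanZ/Defs.sub_span; eexists.
case/span_familyP => c cE; exists c; apply: val_inj; rewrite cE raddf_sum.
by apply: eq_bigr.
Qed.

Section Dual.
Variables (n : nat) (P Q e : nat -> nat) (x : 'I_n -> submod I).
Hypotheses (PQ : staircase a b n P Q)
  (eE : forall k, (k <= n)%N -> (e k + a * b = e 0 + P k * a + Q k * b)%N)
  (xE : forall k, emb (val (x k)) = t ^+ e k)
  (xI : generates [seq x k | k : 'I_n]).

Notation h := (dual_corner a b P Q).

(** The forms y -> y t^(h_k) / t^(e_0); the division is possible on the generators
x_l by [dual_corner_addP]. *)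
Lemma dual_monomial_exists : exists g : 'I_n -> dual_module (submod I),
  forall k y, emb (val (g k) y) * t ^+ e 0 = emb (val y) * t ^+ h k.
Proof.
suff gE (k : 'I_n) : exists g : dual_module (submod I),
    forall y, emb (val g y) * t ^+ e 0 = emb (val y) * t ^+ h k.
  by have [g ?] := choice gE; exists g.
have t0 := expf_neq0 (e 0%N) t_neq0.
have zE (y : submod I) : exists z : R, emb z * t ^+ e 0 = emb (val y) * t ^+ h k.
  have [c ->] := (generates_imageP x).1 xI y.
  have wE (l : 'I_n) : exists w, emb w * t ^+ e 0 = t ^+ (h k + e l).
    have [s /semigroup_emb[w wE] ->] :=
      dual_corner_addP a_gt0 b_gt0 coprime_ab PQ eE (ltn_ord k) (ltn_ord l).
    by exists w; rewrite wE exprD mulrC.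
  have [w {}wE] := choice wE; exists (\sum_l c l * w l).
  rewrite !raddf_sum /= !mulr_suml; apply: eq_bigr => l _.
  by rewrite rmorphM -mulrA wE /= rmorphM xE exprD -mulrA [t ^+ e l * _]mulrC.
have [f fE] := choice zE.
have lf : linear (f : submod I -> R^o).
  move=> r y z; apply/emb_inj/(mulIf t0).
  change (emb (f (r *: y + z)) * t ^+ e 0 = emb (r * f y + f z) * t ^+ e 0).
  by rewrite fE !rmorphD !rmorphM !mulrDl -!mulrA !fE.
by exists (dual_elt lf).
Qed.

Variable g : 'I_n -> dual_module (submod I).
Hypothesis gE : forall k y, emb (val (g k) y) * t ^+ e 0 = emb (val y) * t ^+ h k.

Lemma dual_monomial_value (k l : 'I_n) s : (h k + e l = e 0 + s)%N ->
  emb (val (g k) (x l)) = t ^+ s.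
Proof.
move=> hE; apply: (mulIf (expf_neq0 (e 0%N) t_neq0)).
by rewrite gE xE -!exprD addnC hE addnC.
Qed.

Lemma ideal_irredundant : irredundant_mod m x.
Proof.
move=> c rel.
apply: (powers_irredundant (d := fun k : 'I_n => e k)) => [k l s Ss kl|].
  by apply: val_inj; apply: (corner_irredundant a_gt0 b_gt0 coprime_ab PQ eE) Ss kl.
have /(congr1 emb) : val (\sum_k c k *: x k) = 0 by rewrite rel.
rewrite rmorph0 !raddf_sum => E0.
rewrite -[RHS]E0; apply: eq_bigr => k _.
by rewrite -xE -rmorphM.
Qed.

Lemma dual_irredundant : irredundant_mod m g.
Proof.
have n_gt0 := staircase_n_gt0 a_gt0 b_gt0 coprime_ab PQ.
pose k0 := Ordinal n_gt0.
move=> c rel.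
apply: (powers_irredundant (d := fun k : 'I_n => h k)) => [k l s Ss kl|].
  apply: val_inj.
  by apply: (dual_corner_irredundant a_gt0 b_gt0 coprime_ab PQ) Ss kl.
have /(congr1 emb) : val (\sum_k c k *: g k) (x k0) = 0 by rewrite rel dual_val0.
rewrite rmorph0 dual_val_sum rmorph_sum => E0.
rewrite -[RHS]E0; apply: eq_bigr => k _; rewrite dual_valZ rmorphM.
by rewrite (@dual_monomial_value k k0 (h k)) ?[(_ + e _)%N]addnC.
Qed.

Let tail N := expansion (fun i => (N <= i)%N).
Let H s := exists2 k, (k < n)%N & exists2 s', S s' & s = (h k + s')%N.

(** A form f is determined by r = f(x_0), so it is enough to expand r over the
semigroup ideal H of the exponents h_k.  The leading term c t^N of what is not yet
expanded is accepted if N is in H.  Otherwise some N + e_l is not in e_0 + S, whereas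
t^(e_l) r = t^(e_0) f(x_l) is supported there; this forces c into m, and c t^N moves
to higher degrees.  Beyond h_0 + a b all degrees lie in H. *)
Lemma dual_generates : generates [seq g k | k : 'I_n].
Proof.
have n_gt0 := staircase_n_gt0 a_gt0 b_gt0 coprime_ab PQ.
pose k0 := Ordinal n_gt0.
apply/generates_imageP => f; pose r := val f (x k0).
have t0 := expf_neq0 (e 0%N) t_neq0.
pose T s := exists2 s', S s' & s = (e 0 + s')%N.
have in_cols l : (l < n)%N -> exists2 z, expansion T z
    & t ^+ e l * emb r = z.
  move=> ln; exists (t ^+ e 0 * emb (val f (x (Ordinal ln)))).
    rewrite mulrC; apply: expansion1; exists 0%N; rewrite ?addn0 //; exact: semigroup0.
  have := dual_swap f (x (Ordinal ln)) (x k0) => /(congr1 emb).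
  by rewrite !rmorphM !xE.
have approx N : exists p z, [/\ expansion H p, tail N z & emb r = p + z].
  elim: N => [|N [p [z [Hp Nz rE]]]].
    exists 0, (emb r); split; first exact: expansion0.
      by rewrite -[emb r]mulr1; apply: (@expansion1 _ r 0).
    by rewrite add0r.
  have [|c [z' [_ Nz' zE]]] := @expansion_split (fun=> True) N z.
    by apply: expansion_sub Nz.
  have {}Nz' : tail N.+1 z' by apply: expansion_sub Nz' => i [].
  have [HN|nHN] := pselect (H N).
    exists (p + emb c * t ^+ N), z'; split=> //; last by rewrite rE zE addrA.
    by apply: expansionD => //; apply: expansion1.
  suff cm : c \in m.
    exists p, z; split=> //; rewrite zE; apply: expansionD => //.
    have [r1 [r2 ->]] := m_gen cm.
    rewrite rmorphD !rmorphM embu embv mulrDl -!mulrA -!exprD.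
    by apply: expansionS; [|apply: expansion1]; lia.
  have /existsNP[l /not_implyP[ln nS]] :
      ~ forall l, (l < n)%N -> exists2 s', S s' & (N + e l)%N = (e 0 + s')%N.
    by move/(dual_cornerP a_gt0 b_gt0 coprime_ab PQ eE).
  have [y Ty yE] := in_cols l ln.
  apply: (@expansion_mem_lead T c (N + e l) (t ^+ e l * z')) nS.
  - move=> _ [s Ss ->]; exists (s + a)%N; last by rewrite addnA.
    by apply: semigroupD => //; apply: semigroup_a.
  - move=> _ [s Ss ->]; exists (s + b)%N; last by rewrite addnA.
    by apply: semigroupD => //; apply: semigroup_b.
  - have -> : emb c * t ^+ (N + e l) + t ^+ e l * z' = y - t ^+ e l * p.
      by rewrite -yE rE zE exprD !mulrDr mulrCA [t ^+ N * _]mulrC; ring.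
    apply: expansionB => //; rewrite -[t ^+ _]mul1r -(rmorph1 emb).
    apply: expansion_mul Hp => s Hs.
    have [s' Ss' E0] := (dual_cornerP a_gt0 b_gt0 coprime_ab PQ eE s).2 Hs l ln.
    by exists s'; rewrite // addnC.
  - rewrite -[t ^+ _]mul1r -(rmorph1 emb); apply: expansion_mul Nz' => s; lia.
have Hr : expansion H (emb r).
  have [p [z [Hp Nz ->]]] := approx (h 0 + a * b)%N.
  apply: expansionD => //; apply: expansion_sub Nz => s le_s.
  exists 0%N => //; exists (s - h 0)%N; last by lia.
  have abs : (a * b <= s - h 0)%N by lia.
  have [i [j [_ ->]]] := semigroup_rep a_gt0 b_gt0 coprime_ab abs.
  by exists i, j.
have [|c cE] := expansion_family (d := fun k : 'I_n => h k) semigroup_emb _ Hr.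
  by move=> s [k kn Hs]; exists (Ordinal kn).
exists c; apply: val_inj; apply/funext => y; rewrite dual_val_sum.
apply/emb_inj/(mulIf t0).
transitivity (emb (val y) * emb r).
  by rewrite -(xE k0) -!rmorphM dual_swap mulrC.
rewrite cE mulr_sumr rmorph_sum mulr_suml; apply: eq_bigr => k _.
by rewrite dual_valZ rmorphM -mulrA gE mulrCA.
Qed.

End Dual.

Theorem monomial_tensor_torsion :
  exists s : seq (tensor (submod I) (dual_module (submod I))),
    minimal_generating s /\
    (2 * mu (submod I) - 2 <= count (fun y => `[< torsion y >]) s)%N.
Proof.
have [n [P [Q [e [x [PQ eE xE xI]]]]]] := ideal_staircase.
have [g gE] := dual_monomial_exists PQ eE xE xI.
have irx := ideal_irredundant PQ eE xE.
have irg := dual_irredundant PQ xE gE; have gI := dual_generates PQ eE xE gE.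
have irr := irredundant_tens xI gI irx irg; have gen := generates_tens xI gI.
have n_gt0 := staircase_n_gt0 a_gt0 b_gt0 coprime_ab PQ.
have mu_n : (mu (submod I) <= n)%N.
  by have := mu_le xI; rewrite size_image card_ord.
(* For n = 1 the two kinds of tensors coincide, but the bound is 0. *)
have [n_le1|n_gt1] := leqP n 1.
  have [||s [smin _]] := minimal_generating_torsion (Z := finset.set0) (base := id)
    (c := fun=> 0) irr gen; [by []|by move=> i; rewrite inE|].
  by exists s; split=> //; lia.
pose k0 := Ordinal n_gt0.
pose expv k := (a - (Q k.+1 - Q k))%N; pose expu k := (b - (P k - P k.+1))%N.
have gx (k : 'I_n) : val (g k) (x k) = v ^+ expv k.
  apply: emb_inj; rewrite rmorphXn embv -exprM mulnC.
  apply: (dual_monomial_value xE gE).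
  exact: (dual_corner_add_same a_gt0 b_gt0 coprime_ab PQ eE).
have gxS (k : 'I_n) : val (g k) (x (ordS k)) = u ^+ expu k.
  apply: emb_inj; rewrite rmorphXn embu -exprM mulnC.
  apply: (dual_monomial_value xE gE).
  rewrite -(dual_corner_add_next a_gt0 b_gt0 coprime_ab PQ eE) //; congr addn => /=.
  have := ltn_ord k; rewrite leq_eqVlt => /orP[/eqP->|/modn_small->//].
  by rewrite modnn (corner_last a_gt0 b_gt0 coprime_ab PQ eE).
have ordS_neq (k : 'I_n) : ordS k != k.
  rewrite -val_eqE /=; have := ltn_ord k; rewrite leq_eqVlt => /orP[/eqP kn|kn].
    by rewrite kn modnn; lia.
  by rewrite modn_small // -{2}[k : nat]addn0 -addn1 eqn_add2l.
have [k2 minA] : exists k2 : 'I_n, forall k : 'I_n, (expv k2 <= expv k)%N.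
  case: (@arg_minnP _ k0 xpredT expv isT) => k2 _ min2.
  by exists k2 => k; apply: min2.
have [k1 minB] : exists k1 : 'I_n, forall k : 'I_n, (expu k1 <= expu k)%N.
  case: (@arg_minnP _ k0 xpredT expu isT) => k1 _ min1.
  by exists k1 => k; apply: min1.
(* [diag k] and [off k] index the tensors x_k (x) g_k and x_(k+1) (x) g_k, whose
values are powers of v and of u; k2 and k1 are the indices of least exponent. *)
pose diag (k : 'I_n) := (k, k); pose off (k : 'I_n) := (ordS k, k).
pose Z1 := diag @: [set~ k2]%SET; pose Z2 := off @: [set~ k1]%SET.
pose base (p : 'I_n * 'I_n) := if p.1 == p.2 then diag k2 else off k1.
pose c (p : 'I_n * 'I_n) := if p \in Z1 then v ^+ (expv p.2 - expv k2) else
  if p \in Z2 then u ^+ (expu p.2 - expu k1) else 0.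
have Z1P (i k : 'I_n) : (i, k) \in Z1 -> i = k by case/imsetP => j _ [-> ->].
have Z2P (i k : 'I_n) : (i, k) \in Z2 -> i = ordS k by case/imsetP => j _ [-> ->].
have diagZ2 k : diag k \notin Z2.
  by apply/negP => /Z2P kE; have := ordS_neq k; rewrite -kE eqxx.
have offZ1 k : off k \notin Z1.
  by apply/negP => /Z1P kE; have := ordS_neq k; rewrite kE eqxx.
have diagZ1 : diag k2 \notin Z1.
  by apply/imsetP => -[k]; rewrite !inE => kk2 [k2k]; rewrite k2k eqxx in kk2.
have offZ2 : off k1 \notin Z2.
  by apply/imsetP => -[k]; rewrite !inE => kk1 [_ k1k]; rewrite k1k eqxx in kk1.
have x0_neq0 : val (x k0) != 0.
  apply/eqP => x00; have := xE k0; rewrite x00 rmorph0 => /esym/eqP.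
  by rewrite expf_eq0 (negPf t_neq0) andbF.
have [||s [smin Zs]] := minimal_generating_torsion
  (Z := Z1 :|: Z2) (base := base) (c := c) irr gen.
- move=> p; have [->|->] : base p = diag k2 \/ base p = off k1.
  + by rewrite /base; case: ifP; [left|right].
  + by rewrite /c (negPf diagZ1) (negPf (diagZ2 _)).
  + by rewrite /c (negPf (offZ1 _)) (negPf offZ2).
- case=> i k; rewrite inE /base /c => /orP[iZ|iZ]; rewrite iZ /=.
    rewrite (Z1P _ _ iZ) eqxx; apply: (torsion_tens x0_neq0).
    by rewrite !gx -exprD subnK.
  rewrite (Z2P _ _ iZ) (negPf (offZ1 k)) (negPf (ordS_neq k)).
  by apply: (torsion_tens x0_neq0); rewrite !gxS -exprD subnK.
exists s; split=> //; apply: leq_trans Zs.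
rewrite cardsU (_ : Z1 :&: Z2 = finset.set0) ?cards0 ?subn0.
  rewrite !card_imset ?cardsC1 ?card_ord; first by lia.
    by move=> k l [].
  by move=> k l [].
apply/setP => -[i k]; rewrite !inE; apply/negP => /andP[/Z1P ->].
by rewrite (negPf (diagZ2 k)).
Qed.

End Ideal.
End Expansions.

(** * The coordinate ring of a monomial curve *)

Section MonomialCurve.
Variables (k : fieldType) (a b : nat).

Definition augmentation_ideal : {pred monomial_ring k a b} :=
  fun p => (val p)`_0 == 0.

Lemma augmentation_ideal_closed : idealr_closed augmentation_ideal.
Proof.
split=> [||r p q]; rewrite ?unfold_in /=.
- by rewrite coef0.
- by rewrite coef1 oner_eq0.
- by move=> /eqP p0 /eqP q0; rewrite coefD coef0M p0 q0 mulr0 addr0.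
Qed.

HB.instance Definition _ :=
  isIdealr.Build (monomial_ring k a b) augmentation_ideal augmentation_ideal_closed.

Lemma monomial_subring_comp (q : {poly k}) : q \Po 'X^a \in monomial_subring a b.
Proof. by apply/asboolP; exists q%:P; rewrite map_polyC hornerC. Qed.

Lemma monomial_subring_Xa : ('X^a : {poly k}) \in monomial_subring a b.
Proof. by have := monomial_subring_comp 'X; rewrite comp_polyX. Qed.

Lemma monomial_subring_Xb : ('X^b : {poly k}) \in monomial_subring a b.
Proof. by apply/asboolP; exists 'X; rewrite map_polyX hornerX. Qed.

Definition Xa : monomial_ring k a b := exist _ 'X^a monomial_subring_Xa.
Definition Xb : monomial_ring k a b := exist _ 'X^b monomial_subring_Xb.

(** Split from q(X^a, X^b) the terms divisible by the second variable, then those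
divisible by the first; what remains is the constant term, which is 0. *)
Lemma augmentation_ideal_gen r : (0 < a)%N -> (0 < b)%N ->
  r \in augmentation_ideal -> exists r1 r2, r = r1 * Xa + r2 * Xb.
Proof.
move=> a_gt0 b_gt0; rewrite unfold_in => /eqP.
have /asboolP[q rq] := valP r; move: rq; elim/poly_ind: q => [|q q0 _].
  rewrite rmorph0 horner0 => r0 _; exists 0, 0.
  by apply: val_inj; rewrite !mul0r addr0.
rewrite rmorphD rmorphM /= map_polyX map_polyC hornerMXaddC /=.
set p2 := (map_poly _ q).[_].
have p2R : p2 \in monomial_subring a b by apply/asboolP; exists q.
elim/poly_ind: q0 => [|q0 c _].
  rewrite comp_poly0 addr0 => rE _; exists 0, (exist _ p2 p2R).
  by apply: val_inj; rewrite mul0r add0r.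
rewrite comp_polyD comp_polyM comp_polyX comp_polyC => rE.
rewrite rE !coefD !coefMXn a_gt0 b_gt0 coefC !add0r /= => c0.
pose r1 : monomial_ring k a b :=
  exist _ (q0 \Po 'X^a) (monomial_subring_comp q0).
exists r1, (exist _ p2 p2R).
by apply: val_inj; rewrite /= rE c0 addr0 addrC.
Qed.

Lemma expansion_coef0 y :
  expansion (val : monomial_ring k a b -> {poly k}) 'X (fun i => (0 < i)%N) y ->
  y`_0 = 0.
Proof.
elim=> [|r j {}y j0 _ IH]; first by rewrite coef0.
by rewrite coefD coefMXn j0 IH addr0.
Qed.

End MonomialCurve.

(** * The local case *)

Section LocalCase.
Variables (R : idomainType) (m : idealr R).

Lemma tofrac_inj : injective (@tofrac R).
Proof. by move=> r s /eqP; rewrite tofrac_eq => /eqP. Qed.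

Lemma maximal_ideal_comax r : maximal_ideal m -> r \notin m ->
  exists s c, c \in m /\ 1 = s * r + c.
Proof.
move=> mmax rm; apply: contrapT => nex.
pose J : {pred R} := fun y => `[< exists s c, c \in m /\ y = s * r + c >].
have Jcl : idealr_closed J.
  split=> [||d y z /asboolP[s [c [cm ->]]] /asboolP[s' [c' [cm' ->]]]].
  - by apply/asboolP; exists 0, 0; rewrite rpred0 mul0r addr0.
  - exact/asboolPn.
  - apply/asboolP; exists (d * s + s'), (d * c + c'); split; last by ring.
    by rewrite rpredD // idealMr.
pose J' : idealr R := HB.pack J (isIdealr.Build R J Jcl).
have mJ : {subset m <= J'}.
  by move=> y ym; apply/asboolP; exists 0, y; rewrite mul0r add0r.
have /negP := rm; apply; apply: (mmax J' mJ); apply/asboolP.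
by exists 1, 0; rewrite rpred0 mul1r addr0.
Qed.

(** Multiply the monic equation of y = 1 / w, of degree d, by w^d: it shows that 1 is
a multiple of w. *)
Lemma integral_inverse (w : R) (y : {fraction R}) : tofrac w * y = 1 ->
  integralOver (@tofrac R) y -> exists w', w * w' = 1.
Proof.
move=> wy [p pmon]; rewrite rootE.
have w0 : tofrac w != 0.
  by apply: contra_eq_neq wy => ->; rewrite mul0r eq_sym oner_neq0.
have -> : y = (tofrac w)^-1 by rewrite -[y]mul1r -(mulVf w0) -mulrA wy mulr1.
have [d sp] : exists d, size p = d.+1.
  by exists (size p).-1; rewrite prednK // lt0n size_poly_eq0 monic_neq0.
rewrite horner_coef size_map_inj_poly ?tofrac0 //; last exact: tofrac_inj.
rewrite sp big_ord_recr /= coef_map /=.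
have -> : p`_d = 1 by have /monicP := pmon; rewrite lead_coefE sp.
rewrite rmorph1 mul1r addr_eq0 => /eqP E.
exists (- \sum_(i < d) p`_i * w ^+ (d - i.+1)).
apply: tofrac_inj; rewrite rmorph1 rmorphM rmorphN mulrN rmorph_sum mulr_sumr.
apply: (canLR (@opprK _)); apply: (mulIf (expf_neq0 d (invr_neq0 w0))).
rewrite mulN1r -E mulr_suml; apply: eq_bigr => i _.
rewrite coef_map /= rmorphM rmorphXn.
rewrite mulrCA -exprS -mulrA; congr (_ * _).
have /ltnW id := ltn_ord i; rewrite -subSn // subSS !exprVn.
apply: (canLR (mulfK (expf_neq0 d w0))).
by rewrite -[X in _ * _ ^+ X](subnKC id) exprD mulKf ?expf_neq0.
Qed.

Lemma integralX (t : {fraction R}) n :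
  integralOver (@tofrac R) t -> integralOver (@tofrac R) (t ^+ n).
Proof.
move=> ti; elim: n => [|n IH]; first exact: integral1.
by rewrite exprS; apply: (integral_mul ti IH).
Qed.

Lemma expansion_integral (t : {fraction R}) z : integralOver (@tofrac R) t ->
  expansion (@tofrac R) t (fun i => (0 < i)%N) z ->
  exists2 z', integralOver (@tofrac R) z' & z = t * z'.
Proof.
move=> ti; elim=> [|r j y j0 _ [z' z'i ->]].
  by exists 0; [apply: integral0|rewrite mulr0].
exists (tofrac r * t ^+ j.-1 + z').
  apply: integral_add z'i; apply: integral_mul; first exact: integral_id.
  exact: integralX.
by rewrite mulrDr mulrCA -exprS prednK.
Qed.

(** If r is outside the maximal ideal m, then 1 = s r + c with c in m.  As r and c lie
in t R[t], t is a unit of the integral closure; so is u = t^a, whose inverse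
then lies in R, contradicting that u is in m. *)
Lemma expansion_maximal (t : int_closure R) a u : (0 < a)%N ->
  maximal_ideal m -> u \in m -> to_int_closure u = t ^+ a ->
  (forall c, c \in m ->
     expansion (@tofrac R) (val t) (fun i => (0 < i)%N) (tofrac c)) ->
  forall r, expansion (@tofrac R) (val t) (fun i => (0 < i)%N) (tofrac r) ->
  r \in m.
Proof.
move=> a0 mmax um ut mexp r rexp; apply: contraT => rm.
have [s [c [cm E1]]] := maximal_ideal_comax mmax rm.
have exp1 : expansion (@tofrac R) (val t) (fun i => (0 < i)%N) (tofrac 1).
  have -> : tofrac 1 = tofrac s * val t ^+ 0 * tofrac r + tofrac c.
    by rewrite E1 rmorphD rmorphM mulr1.
  by apply: expansionD; [apply: expansion_mul rexp|apply: mexp].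
have [z zi] := expansion_integral (asboolW (valP t)) exp1; rewrite rmorph1 => tz.
have [|| w uw] := @integral_inverse u (z ^+ a).
- have -> : tofrac u = val t ^+ a by rewrite -rmorphXn -ut.
  by rewrite -exprMn -tz expr1n.
- exact: integralX.
by have := idealMr w um; rewrite mulrC uw idealr1.
Qed.

End LocalCase.

Theorem proposition4p9 (a b : nat) (a_gt1 : (1 < a)%N) (a_lt_b : (a < b)%N)
    (coprime_ab : coprime a b) :
  (forall (k : fieldType) (I : submodClosed (monomial_ring k a b)^o),
     monomial_ideal (fun r : monomial_ring k a b => val r) 'X I ->
     exists s : seq (tensor (submod I) (dual_module (submod I))),
       minimal_generating s /\
       (2 * mu (submod I) - 2 <= count (fun y => `[< torsion y >]) s)%N)
  /\
  (forall (R : idomainType) (m : idealr R) (t : int_closure R),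
     noetherian_local m ->
     krull_dim_is R 1 ->
     analytically_irreducible m ->
     residually_rational m ->
     (exists u v : R,
        [/\ to_int_closure u = t ^+ a, to_int_closure v = t ^+ b
          & [set` m] = lin_span (M := R^o) [set u; v]]) ->
     forall I : submodClosed R^o,
       monomial_ideal (@to_int_closure R) t I ->
       exists s : seq (tensor (submod I) (dual_module (submod I))),
         minimal_generating s /\
         (2 * mu (submod I) - 2 <= count (fun y => `[< torsion y >]) s)%N).
Proof.
have a_gt0 : (0 < a)%N by lia.
have b_gt0 : (0 < b)%N by lia.
split=> [k I I_mon|R m t [_ [mmax _]] dim1 _ _ [u [v [uE vE mE]]] I I_mon].
  pose emb : {rmorphism monomial_ring k a b -> {poly k}} := val.
  have X_neq0 : 'X != 0 :> {poly k} by rewrite polyX_eq0.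
  have gen r (rm : r \in @augmentation_ideal k a b) :=
    augmentation_ideal_gen a_gt0 b_gt0 rm.
  have lead r : expansion emb 'X (fun i => (0 < i)%N) (emb r) ->
      r \in @augmentation_ideal k a b.
    by move=> /expansion_coef0 r0; apply/eqP.
  exact: (@monomial_tensor_torsion (monomial_ring k a b) _ emb 'X X_neq0 a b
    (Xa k a b) (Xb k a b) (@augmentation_ideal k a b) a_gt0 b_gt0 coprime_ab
    erefl erefl gen lead val_inj I I_mon).
have m_gen r : r \in m -> exists r1 r2, r = r1 * u + r2 * v.
  move=> rm; have : [set` m] r by [].
  rewrite mE => -[s suv ->]; elim: s suv => [|p s IH] suv.
    by exists 0, 0; rewrite big_nil !mul0r addr0.
  rewrite big_cons; have [|r1 [r2 ->]] := IH.
    by move=> q qs; apply: suv; rewrite inE qs orbT.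
  have : [set u; v] p.2 by apply: suv; rewrite mem_head.
  case=> ->; [exists (p.1 + r1), r2|exists r1, (p.1 + r2)]; rewrite /=.
    by rewrite mulrDl addrA.
  by rewrite mulrDl addrCA.
have um : u \in m.
  by have : [set` m] u by rewrite mE; apply: Defs.sub_span; left.
have uE' : tofrac u = val t ^+ a by rewrite -rmorphXn -uE.
have vE' : tofrac v = val t ^+ b by rewrite -rmorphXn -vE.
apply: (@monomial_tensor_torsion _ _ (@tofrac R) (val t) _ a b u v m) => //.
(* if t = 0 then m = 0 and R is a field, of dimension 0 *)
- apply/eqP => t0.
  have power0 w n : (0 < n)%N -> tofrac w = val t ^+ n -> w = 0.
    move=> n0; rewrite t0 expr0n -[n == 0]negbK -lt0n n0 => /eqP.
    by rewrite tofrac_eq0 => /eqP.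
  have m0 r : r \in m -> r = 0.
    case/m_gen=> r1 [r2 ->].
    by rewrite (power0 _ _ a_gt0 uE') (power0 _ _ b_gt0 vE') !mulr0 addr0.
  have [[P /(_ 0%N isT)[_ nP01]] _] := dim1; apply: nP01 => r rP1.
  have [/m0->|rm] := boolP (r \in m); first by rewrite rpred0.
  have [s [c [/m0->]]] := maximal_ideal_comax mmax rm; rewrite addr0 => sr.
  by have := idealMr s rP1; rewrite -sr idealr1.
- apply: (expansion_maximal a_gt0 mmax um uE) => c /m_gen[r1 [r2 ->]].
  have -> : tofrac (r1 * u + r2 * v) =
      tofrac r1 * val t ^+ a + tofrac r2 * val t ^+ b.
    by rewrite -uE' -vE' rmorphD !rmorphM.
  by apply: expansionD; apply: expansion1.
- exact: tofrac_inj.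
- have [nz [G GE IG]] := I_mon; split=> //; exists G => // g /GE[n gn]; exists n.
  by rewrite -rmorphXn -gn.
Qed.
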